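(* Fix $(\theta,\rho)$ with $\theta\in\Theta$, $\rho>0$ and $V(\theta,\rho)<+\infty$. Assume: (1) for each $\theta'\in\Theta$ the unit set $\mathcal U_{\theta',1}$ is nonempty, convex, compact, and contains $0$ in its interior; (2) $f$ is bounded below on $\mathcal X$, i.e. $\inf_{x\in\mathcal X}f(x)>-\infty$, and there exists $\bar x\in\operatorname{ri}(\mathcal X)$ with $f(\bar x)<+\infty$ satisfying all constraints strictly, i.e. $a_j(\bar x)+\sigma_{\mathcal U_{\theta,\rho}}(w_j)<b_j$ for all $j=1,\dots,m$; (3) for each $j$ and each $\rho'>0$, the map $\theta'\mapsto\sigma_{\mathcal U_{\theta',\rho'}}(w_j)$ is continuously differentiable on $\Theta$ with locally bounded gradient. Let $\mu^*\in\mathcal M^*(\theta,\rho)$. Then: (a) (Shape gradient) $\displaystyle g_\theta(\theta,\rho;\mu^* ):=\sum_{j=1}^m\mu_j^*\,\nabla_\theta\sigma_{\mathcal U_{\theta,\rho}}(w_j)\in\partial^{\mathrm C}_\theta V(\theta,\rho)$. If the dual optimizer is unique, then $V(\cdot,\rho)$ is differentiable at $\theta$ with gradient $g_\theta(\theta,\rho;\mu^* )$. (b) (Radius gradient) $\displaystyle g_\rho(\theta,\rho;\mu^* ):=\sum_{j=1}^m\mu_j^*\,\sigma_{\mathcal U_{\theta,1}}(w_j)\in\partial^{\mathrm C}_\rho V(\theta,\rho)$.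
   Context: Let $d\ge1$ and $\Theta\subseteq\mathbb R^p$. For shape $\theta\in\Theta$ and radius $\rho>0$ the uncertainty set is $\mathcal U_{\theta,\rho}=\{u\in\mathbb R^d: s_\theta(u)\le\rho\}$, where $s_\theta:\mathbb R^d\to[0,\infty)$ is the gauge function of the unit set $\mathcal U_{\theta,1}$, i.e. $s_\theta(u)=\inf\{t>0: u\in t\,\mathcal U_{\theta,1}\}$; under hypothesis (1), $\mathcal U_{\theta,\rho}=\rho\,\mathcal U_{\theta,1}$ for all $\rho>0$. The support function of $C\subseteq\mathbb R^d$ is $\sigma_C(w)=\sup_{u\in C}\langle w,u\rangle$. Let $\mathcal X\subseteq\mathbb R^{n_x}$ be a closed convex decision set with relative interior $\operatorname{ri}(\mathcal X)$, $f:\mathbb R^{n_x}\to\mathbb R\cup\{+\infty\}$ convex, $a_1,\dots,a_m$ convex constraint functions on $\mathbb R^{n_x}$, $w_1,\dots,w_m\in\mathbb R^d$ fixed exposure vectors and $b_1,\dots,b_m$ fixed scalars. Define $$V(\theta,\rho)=\inf\{f(x): x\in\mathcal X,\ a_j(x)+\sigma_{\mathcal U_{\theta,\rho}}(w_j)\le b_j,\ j=1,\dots,m\},$$ with $V(\theta,\rho)=+\infty$ if the feasible set is empty. The Lagrange dual function is $$q(\mu;\theta,\rho)=\inf_{x\in\mathcal X}\Big\{f(x)+\sum_{j=1}^m\mu_j\big(a_j(x)+\sigma_{\mathcal U_{\theta,\rho}}(w_j)-b_j\big)\Big\},\qquad \mu\in\mathbb R^m,\ \mu\ge0,$$ and $\mathcal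 M^*(\theta,\rho)=\operatorname{argmax}_{\mu\ge0}q(\mu;\theta,\rho)$ is the set of optimal dual multipliers (nonempty under hypothesis (2)). For a locally Lipschitz function $h:\mathbb R^p\to\mathbb R$, the Clarke subdifferential at $x$ is $\partial^{\mathrm C}h(x)=\operatorname{conv}\{\lim_{k\to\infty}\nabla h(x_k): x_k\to x,\ h\text{ differentiable at }x_k\}$. $\partial^{\mathrm C}_\theta V(\theta,\rho)$ denotes the Clarke subdifferential of $V(\cdot,\rho)$ at $\theta$, and $\partial^{\mathrm C}_\rho V(\theta,\rho)$ that of $V(\theta,\cdot)$ at $\rho$.
   Formalization: Part (a) is stated for θ in the interior of Θ, since at a boundary point V(·,ρ) is not defined on a neighbourhood of θ and its Clarke subdifferential and gradient there have no meaning. *)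

(* Defs.v *)
(* MathComp-Analysis, over an arbitrary [R : realType]; vectors of R^k are
   row vectors ['rV[R]_k]. *)
From HB Require Import structures.
From mathcomp Require Export all_boot all_order all_algebra.
From mathcomp Require Export all_classical all_reals all_analysis.

Set Implicit Arguments.
Unset Strict Implicit.
Unset Printing Implicit Defensive.

Import Order.TTheory GRing.Theory Num.Theory.
Export numFieldNormedType.Exports.

Local Open Scope classical_set_scope.
Local Open Scope ring_scope.
Local Open Scope convex_scope.

Definition dot {R : realType} {k : nat} (u v : 'rV[R]_k) : R :=
  \sum_(i < k) u 0 i * v 0 i.

Definition affine_hull {R : realType} {k : nat} (A : set 'rV[R]_k) :
    set 'rV[R]_k :=
  [set x | exists r (c : 'I_r -> R) (y : 'I_r -> 'rV[R]_k),
     [/\ \sum_(i < r) c i = 1, forall i, A (y i) &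
         x = \sum_(i < r) c i *: y i]].

Definition relint {R : realType} {k : nat} (A : set 'rV[R]_k) :
    set 'rV[R]_k :=
  [set x | A x /\ \forall y \near x, affine_hull A y -> A y].

Definition convex_hull {R : realType} {k : nat} (A : set 'rV[R]_k) :
    set 'rV[R]_k :=
  smallest (@convex_set R 'rV[R]_k) A.

Definition support {R : realType} {k : nat} (C : set 'rV[R]_k)
    (w : 'rV[R]_k) : \bar R :=
  ereal_sup [set (dot w u)%:E | u in C].

Definition gauge {R : realType} {k : nat} (C : set 'rV[R]_k)
    (u : 'rV[R]_k) : \bar R :=
  ereal_inf [set t%:E | t in [set t : R |
    0 < t /\ [set t *: v | v in C] u]].

(* At a coefficient 0 the convention 0 * +oo = 0 of [\bar R] applies. *)
Definition econvex {R : realType} {k : nat} (f : 'rV[R]_k -> \bar R) : Prop :=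
  forall (t : {i01 R}) (x y : convex_lmodType 'rV[R]_k),
    (f (x <| t |> y) <= t%:num%:E * f x + (1 - t%:num)%:E * f y)%E.

Definition grad {R : realType} {k : nat} (h : 'rV[R]_k -> R)
    (x : 'rV[R]_k) : 'rV[R]_k :=
  \row_(i < k) 'D_(delta_mx 0 i) h x.

(* Continuous differentiability, with locally bounded gradient, on a set D
   that need not be open: increments are taken inside D.  At the interior
   points of D the witness G is the usual gradient. *)
Definition C1_locbounded_on {R : realType} {k : nat} (D : set 'rV[R]_k)
    (h : 'rV[R]_k -> R) : Prop :=
  exists G : 'rV[R]_k -> 'rV[R]_k,
    [/\ forall x, D x -> let F := within D (nbhs x) in
          (fun y => h y - h x - dot (G x) (y - x)) =o_F (fun y => y - x),
        {within D, continuous G} &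
        [locally [bounded G x | x in D]]].

Definition clarke_subdiff {R : realType} {k : nat} (h : 'rV[R]_k -> R)
    (x : 'rV[R]_k) : set 'rV[R]_k :=
  convex_hull [set l | exists z : nat -> 'rV[R]_k,
    [/\ z @ \oo --> x,
        forall i, differentiable h (z i) &
        grad h (z i) @[i --> \oo] --> l]].

(* The domain condition of the Clarke subdifferential, for an extended-valued
   function: real-valued and Lipschitz on a neighbourhood of x. *)
Definition finite_lipschitz_near {R : realType} {k : nat}
    (h : 'rV[R]_k -> \bar R) (x : 'rV[R]_k) : Prop :=
  exists2 A : set 'rV[R]_k, nbhs x A &
    (forall y, A y -> h y \is a fin_num) /\
    [lipschitz fine (h y) | y in A].

(* [s theta u] stands for s_theta(u). *)
Definition uset {R : realType} {p d : nat} (s : 'rV[R]_p -> 'rV[R]_d -> R)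
    (theta : 'rV[R]_p) (rho : R) : set 'rV[R]_d :=
  [set u | s theta u <= rho].

Definition value {R : realType} {p d n m : nat}
    (s : 'rV[R]_p -> 'rV[R]_d -> R) (X : set 'rV[R]_n)
    (f : 'rV[R]_n -> \bar R) (a : 'I_m -> 'rV[R]_n -> R)
    (w : 'I_m -> 'rV[R]_d) (b : 'I_m -> R)
    (theta : 'rV[R]_p) (rho : R) : \bar R :=
  ereal_inf [set f x | x in [set x | X x /\ forall j,
    ((a j x)%:E + support (uset s theta rho) (w j) <= (b j)%:E)%E]].

Definition dual_fun {R : realType} {p d n m : nat}
    (s : 'rV[R]_p -> 'rV[R]_d -> R) (X : set 'rV[R]_n)
    (f : 'rV[R]_n -> \bar R) (a : 'I_m -> 'rV[R]_n -> R)
    (w : 'I_m -> 'rV[R]_d) (b : 'I_m -> R)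
    (theta : 'rV[R]_p) (rho : R) (mu : 'rV[R]_m) : \bar R :=
  ereal_inf [set (f x + \sum_(j < m) (mu 0 j)%:E *
    ((a j x)%:E + support (uset s theta rho) (w j) - (b j)%:E))%E | x in X].

Definition dual_opt {R : realType} {p d n m : nat}
    (s : 'rV[R]_p -> 'rV[R]_d -> R) (X : set 'rV[R]_n)
    (f : 'rV[R]_n -> \bar R) (a : 'I_m -> 'rV[R]_n -> R)
    (w : 'I_m -> 'rV[R]_d) (b : 'I_m -> R)
    (theta : 'rV[R]_p) (rho : R) : set 'rV[R]_m :=
  [set mu : 'rV[R]_m | (forall j, 0 <= mu 0 j) /\
    forall nu : 'rV[R]_m, (forall j, 0 <= nu 0 j) ->
      (dual_fun s X f a w b theta rho nu <=
       dual_fun s X f a w b theta rho mu)%E].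

(* Main.v *)
From HB Require Import structures.
Require Import Defs.
From mathcomp Require Import ring lra.

(** The optimal value depends on theta and rho only through the vector c of the
    support values sigma_j, so it is v o c, where v (c) is the infimum of f over
    the points of X with a_j (x) + c_j <= b_j.  This v is convex; the Slater
    point bounds it from above and the infimum of f from below on a ball
    around the current vector c0, so v is Lipschitz near c0 and has subgradients
    there ([convex_lipschitz], [subgrad_exists]).  By Lagrange duality its
    subgradients at c0 are exactly the optimal multipliers ([dual_opt_subgrad],
    [subgrad_dual_opt]).

    What remains concerns h = v o c, with v convex and c of class C1: in (a),
    c is theta' |-> sigma (theta', rho); in (b) it is r |-> r sigma (theta, 1),
    because gauges are homogeneous ([support_uset]).  The vector
    g = sum_j mu_j grad c_j is a Fréchet subgradient of h, by the chain rule.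
    To see that it is a Clarke subgradient, separate: were g outside the convex
    hull of the limiting gradients, which is compact by Carathéodory's theorem,
    some direction d would separate them strictly ([mem_convex_hull]).  But h
    has gradients near the base point whose slope along d is at least that of g,
    up to an arbitrarily small error ([gradient_slope_ge]).  Here is why.  Near
    the base point h has a subgradient everywhere, so it is differentiable
    wherever a smooth function touches it from above, and paraboloids do so on a
    dense set ([differentiable_dense]).  The uniform subgradient inequality at
    such a point, reached by a short step along d, bounds the slope from below.

    If the multiplier is unique, the subgradients of v at nearby points tend to
    it, by closedness of the graph of the subdifferential.  The subgradient
    inequalities at c0 and at a nearby point then enclose v o c between two
    functions with the same first-order expansion
    ([convex_composite_differentiable]). *)

Set Implicit Arguments.
Unset Strict Implicit.
Unset Printing Implicit Defensive.

Import Order.TTheory GRing.Theory Num.Theory.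

Local Open Scope classical_set_scope.
Local Open Scope ring_scope.

(** * Vectors with the scalar product and the sup norm *)

Section EuclideanSpace.
Context {R : realType} {k : nat}.
Implicit Types (u v x y : 'rV[R]_k) (r e M : R).

Lemma dotC u v : dot u v = dot v u.
Proof. by apply: eq_bigr => i _; rewrite mulrC. Qed.

Lemma dotDl u v x : dot (u + v) x = dot u x + dot v x.
Proof. by rewrite /dot -big_split; apply: eq_bigr => i _; rewrite mxE mulrDl. Qed.

Lemma dotZl r u v : dot (r *: u) v = r * dot u v.
Proof. by rewrite /dot mulr_sumr; apply: eq_bigr => i _; rewrite mxE mulrA. Qed.

Lemma dotDr u v x : dot x (u + v) = dot x u + dot x v.
Proof. by rewrite dotC dotDl !(dotC x). Qed.

Lemma dotZr r u v : dot v (r *: u) = r * dot v u.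
Proof. by rewrite dotC dotZl dotC. Qed.

Lemma dotNl u v : dot (- u) v = - dot u v.
Proof. by rewrite -scaleN1r dotZl mulN1r. Qed.

Lemma dotNr u v : dot v (- u) = - dot v u.
Proof. by rewrite dotC dotNl dotC. Qed.

Lemma dotBl u v x : dot (u - v) x = dot u x - dot v x.
Proof. by rewrite dotDl dotNl. Qed.

Lemma dotBr u v x : dot x (u - v) = dot x u - dot x v.
Proof. by rewrite dotDr dotNr. Qed.

Lemma dot0r u : dot u 0 = 0.
Proof. by rewrite -(scale0r u) dotZr mul0r. Qed.

Lemma dotDD u v : dot (u + v) (u + v) = dot u u + 2 * dot u v + dot v v.
Proof. rewrite dotDl !dotDr (dotC v u); ring. Qed.

Lemma dot_delta u i : dot u (delta_mx 0 i) = u 0 i.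
Proof.
rewrite /dot (bigD1 i)//= mxE !eqxx mulr1 big1 ?addr0// => j ji.
by rewrite mxE (negbTE ji) andbF mulr0.
Qed.

Lemma dot_sumZl (I : finType) (c : I -> R) (F : I -> 'rV[R]_k) v :
  dot (\sum_i c i *: F i) v = \sum_i c i * dot (F i) v.
Proof.
rewrite (big_morph (fun u => dot u v) (id1 := 0) (op1 := +%R)).
- by apply: eq_bigr => i _; rewrite dotZl.
- by move=> u1 u2; rewrite dotDl.
- by rewrite dotC dot0r.
Qed.

Lemma normr_coord u i : `|u 0 i| <= `|u|.
Proof.
rewrite [leRHS]/Num.norm/= mx_normrE; apply/bigmax_geP; right => /=.
by exists (0, i).
Qed.

Lemma normr_le_coord u M : 0 <= M -> (forall i, `|u 0 i| <= M) -> `|u| <= M.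
Proof.
move=> M0 uM; rewrite [leLHS]/Num.norm/= mx_normrE; apply/bigmax_leP; split => //.
by move=> [i j] _ /=; rewrite ord1.
Qed.

Lemma ler_norm_dot u v : `|dot u v| <= k%:R * (`|u| * `|v|).
Proof.
rewrite (le_trans (ler_norm_sum _ _ _))//.
rewrite [leRHS](_ : _ = \sum_(i < k) (`|u| * `|v|)).
  by apply: ler_sum => i _; rewrite normrM ler_pM// normr_coord.
by rewrite sumr_const card_ord mulr_natl.
Qed.

Lemma dotuu_ge u : `|u| ^+ 2 <= dot u u.
Proof.
have uu i : u 0 i * u 0 i = `|u 0 i| ^+ 2 by rewrite real_normK// num_real.
have uu0 : 0 <= dot u u by apply: sumr_ge0 => i _; rewrite uu sqr_ge0.
rewrite -(sqr_sqrtr uu0) ler_pXn2r ?nnegrE ?sqrtr_ge0//.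
apply: normr_le_coord => [|i]; first exact: sqrtr_ge0.
rewrite -(ler_pXn2r (n := 2))// ?nnegrE ?sqrtr_ge0// sqr_sqrtr//.
rewrite -uu /dot (bigD1 i)//= lerDl; apply: sumr_ge0 => j _.
by rewrite uu sqr_ge0.
Qed.

Lemma dotuu_continuous : continuous (fun u : 'rV[R]_k => dot u u).
Proof.
apply: continuous_big => [|i _ u]; first exact: add_continuous.
have cu : {for u, continuous (fun v : 'rV[R]_k => v 0 i)}.
  exact: coord_continuous.
exact: (cvgM cu cu).
Qed.

Lemma paraboloid_continuous r x :
  continuous (fun u : 'rV[R]_k => r * dot (u - x) (u - x)).
Proof.
move=> u; have cu : {for u, continuous (fun u : 'rV[R]_k => dot (u - x) (u - x))}.
  apply: (@continuous_comp _ _ _ (fun u : 'rV[R]_k => u - x) (fun v => dot v v)).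
    by apply: continuousB; [move=> ?; exact: cvg_id|exact: cst_continuous].
  exact: dotuu_continuous.
exact: (cvgM (@cst_continuous _ _ r u) cu).
Qed.

Lemma compact_normB_le x r : compact [set y | `|y - x| <= r].
Proof.
apply: bounded_closed_compact.
  exists (`|x| + r); split; first by rewrite num_real.
  move=> M xM y /= yx; rewrite (le_trans _ (ltW xM))//.
  by rewrite -(subrK x y) (le_trans (ler_normD _ _))// addrC lerD2l.
rewrite (_ : mkset _ = closed_ball_ Num.norm x r); first exact: closed_closed_ball_.
by apply/seteqP; split => y; rewrite /closed_ball_/= distrC.
Qed.

(** Bolzano-Weierstrass, phrased with cluster values so that no subsequence
    has to be extracted. *)
Lemma bounded_cluster_value (u : nat -> 'rV[R]_k) M : (forall i, `|u i| <= M) ->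
  exists l, forall e, 0 < e -> forall N, exists2 i, (N <= i)%N & `|u i - l| < e.
Proof.
move=> uM; have [|l [_ ul]] := @compact_normB_le 0 M (u @ \oo) _.
  by exists 0%N => // i _; rewrite /= subr0.
exists l => e e0 N.
have uN : (u @ \oo) (u @` [set i | (N <= i)%N]) by exists N => // i Ni; exists i.
have [_ [[i /= Ni <-] li]] := ul _ _ uN (nbhsx_ballx l e e0).
by exists i => //; rewrite -normrN opprB; move: li; rewrite -ball_normE.
Qed.

End EuclideanSpace.

(** * Convex hulls of compact sets *)

Section ConvexHull.
Context {R : realType} {k : nat}.
Implicit Types (A B K : set 'rV[R]_k) (x y z g : 'rV[R]_k) (t : R).

Lemma convex_setP A x y t : convex_set A -> 0 <= t -> t <= 1 -> A x -> A y ->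
  A (t *: x + (1 - t) *: y).
Proof.
move=> cA t0 t1 Ax Ay; have t01 : 0 <= t <= 1 by rewrite t0 t1.
have := cA x y (Itv01 t0 t1); rewrite !inE => /(_ Ax Ay).
by rewrite /conv/=.
Qed.

(** Iterated on K, this gives the convex combinations of a bounded number of
    points of K as a continuous image of a product, hence compact with K. *)
Definition segments_from A B : set 'rV[R]_k :=
  (fun q : R * ('rV[R]_k * 'rV[R]_k) => q.1 *: q.2.1 + (1 - q.1) *: q.2.2) @`
    (`[0, 1] `*` (A `*` B)).

Fixpoint combinations K (r : nat) : set 'rV[R]_k :=
  if r is r'.+1 then segments_from K (combinations K r') else K.

Lemma compact_segments_from A B :
  compact A -> compact B -> compact (segments_from A B).
Proof.
move=> cA cB; apply: continuous_compact; last first.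
  by apply: compact_setX; [exact: segment_compact|exact: compact_setX].
apply: continuous_subspaceT => q.
have c1 : {for q, continuous (fun q : R * ('rV[R]_k * 'rV[R]_k) => q.1)}.
  exact: cvg_fst.
have c2 : {for q, continuous (fun q : R * ('rV[R]_k * 'rV[R]_k) => q.2)}.
  exact: cvg_snd.
have c21 : {for q, continuous (fun q : R * ('rV[R]_k * 'rV[R]_k) => q.2.1)}.
  by apply: (continuous_comp c2); exact: cvg_fst.
have c22 : {for q, continuous (fun q : R * ('rV[R]_k * 'rV[R]_k) => q.2.2)}.
  by apply: (continuous_comp c2); exact: cvg_snd.
apply: cvgD; apply: cvgZ => //.
by apply: cvgB => //; exact: cvg_cst.
Qed.

Lemma compact_combinations K r : compact K -> compact (combinations K r).
Proof. by move=> cK; elim: r => //= r; exact: compact_segments_from. Qed.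

Lemma sub_combinations K r : K `<=` combinations K r.
Proof.
elim: r => //= r Kr x Kx; exists (1, (x, x)) => /=.
  by split; [rewrite /= in_itv/= ler01 lexx|split => //; exact: Kr].
by rewrite subrr scale0r addr0 scale1r.
Qed.

Lemma combinationsP K r x : combinations K r x <->
  exists (c : 'I_r.+1 -> R) (y : 'I_r.+1 -> 'rV[R]_k),
    [/\ forall i, 0 <= c i, \sum_i c i = 1, forall i, K (y i) &
        x = \sum_i c i *: y i].
Proof.
elim: r x => [|r IH] x.
  split => [Kx|[c [y [_ c1 Ky ->]]]].
    exists (fun=> 1), (fun=> x); split => //; first by rewrite big_ord1.
    by rewrite big_ord1 scale1r.
  by rewrite big_ord1; move: c1; rewrite big_ord1 => ->; rewrite scale1r; exact: Ky.
split => [[[t [y0 z]] /= [/= t01 [/= Ky0 /IH[c [y [c0 c1 Ky ->]]]]] <-]|].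
  move: t01; rewrite in_itv/= => /andP[t0 t1].
  exists (fun i => if unlift ord0 i is Some j then (1 - t) * c j else t).
  exists (fun i => if unlift ord0 i is Some j then y j else y0); split.
  - by move=> i; case: (unlift ord0 i) => // j; rewrite mulr_ge0// subr_ge0.
  - rewrite big_ord_recl /= unlift_none.
    under eq_bigr do rewrite liftK.
    by rewrite -mulr_sumr c1 mulr1 addrC subrK.
  - by move=> i; case: (unlift ord0 i).
  - rewrite [RHS]big_ord_recl /= unlift_none; congr (_ + _).
    under [RHS]eq_bigr do rewrite liftK -scalerA.
    by rewrite scaler_sumr.
move=> [c [y [c0 c1 Ky ->]]]; rewrite [X in combinations _ _ X]big_ord_recl.
pose s := \sum_(i < r.+1) c (lift ord0 i).
have cs : c ord0 + s = 1 by rewrite -c1 [RHS]big_ord_recl.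
have s0 : 0 <= s by exact: sumr_ge0.
have sE : 1 - c ord0 = s by rewrite -cs addrC addKr.
exists (c ord0, (y ord0, s^-1 *: \sum_(i < r.+1) c (lift ord0 i) *: y (lift ord0 i)
   + (s == 0)%:R *: y ord0)) => /=; last first.
  congr (_ + _); rewrite sE scalerDr !scalerA.
  have [s_eq0|sn0] := eqVneq s 0; last first.
    by rewrite mulfV// scale1r mulr0 scale0r addr0.
  rewrite s_eq0 !mul0r !scale0r addr0; apply/esym/big1 => i _.
  move/eqP: s_eq0; rewrite psumr_eq0// => /allP /(_ i); rewrite mem_index_enum.
  by move=> /(_ isT)/eqP ->; rewrite scale0r.
split; first by rewrite /= in_itv/= c0/= -subr_ge0 sE.
split => //=; have [s_eq0|sn0] := eqVneq s 0.
  by rewrite s_eq0 invr0 scale0r add0r scale1r; apply: sub_combinations.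
rewrite scale0r addr0; apply/IH.
exists (fun i => s^-1 * c (lift ord0 i)), (fun i => y (lift ord0 i)); split => //.
- by move=> i; rewrite mulr_ge0// invr_ge0.
- by rewrite -mulr_sumr mulVf.
- by rewrite scaler_sumr; apply: eq_bigr => i _; rewrite scalerA.
Qed.

Lemma combinations_sub K r A : convex_set A -> K `<=` A -> combinations K r `<=` A.
Proof.
move=> cA KA; elim: r => //= r KrA _ [[t [x y]] /= [/= t01 [/= Kx Ky]] <-].
by move: t01; rewrite in_itv/= => /andP[t0 t1]; apply: convex_setP => //; auto.
Qed.

(** Carathéodory's reduction step: k + 2 points of a k-dimensional space are
    affinely dependent, and moving the weights along the dependency until one
    of them vanishes frees a point. *)
Lemma caratheodory K r : (k <= r)%N -> combinations K r.+1 `<=` combinations K r.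
Proof.
move=> kr _ /combinationsP[c [y [c0 c1 Ky ->]]].
pose M : 'M[R]_(r.+2, k + 1) := \matrix_i row_mx (y i) 1.
have kerM : kermx M != 0.
  rewrite kermx_eq0; apply/negP => /eqP rM.
  have := rank_leq_col M; rewrite rM addn1 ltnS.
  by move=> /leq_trans /(_ kr); rewrite ltnn.
have [a aM an0] : exists2 a : 'rV[R]_r.+2, a *m M = 0 & a != 0.
  have /rowV0Pn[a ak an0] := kerM.
  by exists a => //; apply/sub_kermxP.
have aME j : \sum_i a 0 i * M i j = 0.
  by have /matrixP/(_ 0 j) := aM; rewrite !mxE.
have ay : \sum_i a 0 i *: y i = 0.
  apply/rowP => j; rewrite summxE mxE -[RHS](aME (lshift 1 j)).
  by apply: eq_bigr => i _; rewrite [M _ _]mxE row_mxEl mxE.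
have a1 : \sum_i a 0 i = 0.
  rewrite -[RHS](aME (rshift k 0)).
  by apply: eq_bigr => i _; rewrite [M _ _]mxE row_mxEr mxE eqxx mulr1.
have [i0 ai0] : exists i, 0 < a 0 i.
  apply/not_existsP => an; move/eqP: an0; apply; apply/rowP => j; rewrite mxE.
  have a_le0 i : 0 <= - a 0 i by rewrite oppr_ge0 leNgt; apply/negP/an.
  have /eqP : \sum_i - a 0 i = 0 by rewrite sumrN a1 oppr0.
  rewrite psumr_eq0// => /allP /(_ j); rewrite mem_index_enum => /(_ isT).
  by rewrite oppr_eq0 => /eqP.
(* i1 is the first weight to vanish when c moves in the direction of - a. *)
have [i1 ai1 i1min] := arg_minP (P := fun i => 0 < a 0 i) (fun i => c i / a 0 i) ai0.
pose t := c i1 / a 0 i1.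
have t0 : 0 <= t by rewrite divr_ge0// ltW.
pose c' i := c i - t * a 0 i.
have c'i1 : c' i1 = 0 by rewrite /c' /t divfK ?subrr// gt_eqF.
apply/combinationsP.
exists (fun i => c' (lift i1 i)), (fun i => y (lift i1 i)); split => //.
- move=> i; rewrite /c' subr_ge0; set j := lift i1 i.
  have [aj|aj] := ltP 0 (a 0 j); first by rewrite -ler_pdivlMr// i1min.
  by rewrite (le_trans _ (c0 j))// mulr_ge0_le0.
- transitivity (\sum_i c' i).
    by rewrite (bigD1_ord i1)//= c'i1 add0r.
  by rewrite /c' big_split/= sumrN -mulr_sumr a1 mulr0 subr0.
- transitivity (\sum_i c' i *: y i).
    rewrite /c'; under [RHS]eq_bigr do rewrite scalerBl -scalerA.
    by rewrite sumrB -scaler_sumr ay scaler0 subr0.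
  by rewrite (bigD1_ord i1)//= c'i1 scale0r add0r.
Qed.

(** A point outside the hull of a compact set K is strictly separated from K
    by the direction pointing to it from its nearest point in the hull.  The
    nearest point exists because, by Carathéodory, the combinations of k + 1
    points of K already form the hull, and they form a compact set. *)
Lemma mem_convex_hull K g : compact K ->
  (forall d, exists2 l, K l & dot g d <= dot l d) -> convex_hull K g.
Proof.
move=> cK gK; pose T := combinations K k.
have [l0 Kl0 _] := gK 0.
have T0 : T !=set0 by exists l0; exact: sub_combinations.
have cont : {within T, continuous (fun x => dot (g - x) (g - x))}.
  apply: continuous_subspaceT => x.
  have cx : {for x, continuous (fun x : 'rV[R]_k => g - x)}.
    by apply: continuousB; [exact: cst_continuous|move=> ?; exact: cvg_id].
  apply: (@continuous_comp _ _ _ (fun x : 'rV[R]_k => g - x) (fun u => dot u u)) => //.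
  exact: dotuu_continuous.
have [z /set_mem Tz zmin] := EVT_min_rV T0 (compact_combinations (r := k) cK) cont.
set d := g - z in zmin; have [l Kl gl] := gK d.
have near_z t : 0 < t -> t <= 1 -> 2 * dot d (l - z) <= t * dot (l - z) (l - z).
  move=> t0 t1; pose x := t *: l + (1 - t) *: z.
  have Tx : T x.
    apply: (caratheodory (leqnn k)); exists (t, (l, z)) => //=.
    by split; [rewrite /= in_itv/= (ltW t0) t1|].
  have := zmin x (mem_set Tx).
  have -> : g - x = d - t *: (l - z).
    by apply/rowP => i; rewrite !mxE; ring.
  move: (l - z) (d) => e d'.
  rewrite dotBl !dotBr !dotZr !dotZl (dotC e d') => h.
  rewrite -(ler_pM2l t0); lra.
have dlz : dot d (l - z) <= 0.
  rewrite leNgt; apply/negP => dlz0; set e := dot (l - z) (l - z) in near_z.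
  have e0 : 0 <= e by rewrite (le_trans (sqr_ge0 _) (dotuu_ge _)).
  pose t := Num.min 1 (dot d (l - z) / (e + 1)).
  have t0 : 0 < t by rewrite lt_min ltr01 divr_gt0// ltr_wpDl.
  have := near_z t t0; rewrite ge_min lexx => /(_ isT).
  rewrite leNgt => /negP; apply.
  rewrite (@le_lt_trans _ _ (dot d (l - z) / (e + 1) * e))//.
    by rewrite ler_wpM2r// ge_min lexx orbT.
  rewrite mulrAC ltr_pdivrMr ?ltr_wpDl//; nra.
have d0 : dot d d <= 0.
  rewrite (le_trans _ dlz)// /d -/d !dotBr lerD2r (dotC d g) (dotC d l).
  by rewrite (le_trans _ gl)// /d.
have -> : g = z.
  apply/eqP; rewrite -subr_eq0 -normr_eq0 -sqrf_eq0; apply/eqP/le_anti.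
  by rewrite (le_trans (dotuu_ge _) d0) sqr_ge0.
by move=> A [cA KA]; exact: (@combinations_sub K k).
Qed.

End ConvexHull.

(** * Fréchet subgradients are Clarke subgradients *)

Lemma differentiable_estimate {R : realType} (V W : normedModType R)
    (f : V -> W) (df : {linear V -> W}) x : continuous df ->
  (forall e, 0 < e ->
     \forall y \near x, `|f y - f x - df (y - x)| <= e * `|y - x|) ->
  differentiable f x /\ 'd f x = df :> (V -> W).
Proof.
move=> df_cont fE; have hE : f \o shift x = cst (f x) + df +o_ 0 id.
  apply/eqaddoP => e e0; have /nbhs_normP[r r0 rP] := fE e e0.
  apply/nbhs_normP; exists r => // y; rewrite /ball_/= sub0r normrN => yr.
  have := rP (y + x); rewrite /ball_/= opprD addrCA subrr addr0 normrN => /(_ yr).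
  by rewrite addrK -addrA -opprD.
have dE := diff_unique df_cont hE.
by split => //; apply/diff_locallyP; split; rewrite dE.
Qed.

Lemma differentiable_estimateV {R : realType} (V W : normedModType R)
    (f : V -> W) x : differentiable f x -> forall e, 0 < e ->
  \forall y \near x, `|f y - f x - 'd f x (y - x)| <= e * `|y - x|.
Proof.
move=> df e e0; have /diff_locally/eqaddoP/(_ e e0)/nbhs_normP[r r0 rP] := df.
apply/nbhs_normP; exists r => // y yr.
have := rP (y - x); rewrite /ball_/= sub0r opprB => /(_ yr).
rewrite -[X in `|X|]/(f (y - x + x) - (f x + 'd f x (y - x))).
by rewrite subrK opprD addrA.
Qed.

Section FrechetSubgradient.
Context {R : realType} {k : nat}.
Implicit Types (h : 'rV[R]_k -> R) (x y z g d : 'rV[R]_k) (e t : R).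

Lemma near_normP x (P : 'rV[R]_k -> Prop) :
  (\forall y \near x, P y) <->
  exists2 r, 0 < r & forall y, `|y - x| < r -> P y.
Proof.
split => [/nbhs_normP[r r0 rP]|[r r0 rP]].
  by exists r => // y; rewrite distrC => /rP.
by apply/nbhs_normP; exists r => // y; rewrite /ball_/= distrC => /rP.
Qed.

Lemma near_ray x d (P : 'rV[R]_k -> Prop) : (\forall y \near x, P y) ->
  exists2 t, 0 < t & P (x + t *: d).
Proof.
move=> /near_normP[r r0 rP]; exists (r / 2 / (`|d| + 1)).
  by rewrite !divr_gt0// ltr_wpDl.
have d1 : 0 < `|d| + 1 by rewrite ltr_wpDl.
apply: rP; rewrite /= (addrC x) addrK normrZ gtr0_norm; last by rewrite !divr_gt0.
rewrite mulrAC ltr_pdivrMr//; have := normr_ge0 d; nra.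
Qed.

Definition frechet_subgrad h x g :=
  forall e, 0 < e -> \forall y \near x, h x + dot g (y - x) - e * `|y - x| <= h y.

(** An alias of [dot g] to which the linear structure is attached. *)
Definition dot_linear g : 'rV[R]_k -> R := dot g.

Lemma dot_linear_is_linear g : linear (dot_linear g : 'rV[R]_k -> R^o).
Proof. by move=> a u v; rewrite /dot_linear dotDr dotZr. Qed.

HB.instance Definition _ g := GRing.isLinear.Build R 'rV[R]_k R^o _
  (dot_linear g) (dot_linear_is_linear g).

Lemma dot_linear_continuous g : continuous (dot_linear g : 'rV[R]_k -> R^o).
Proof.
apply: continuous_big => [|i _ u]; first exact: add_continuous.
have cu : {for u, continuous (fun v : 'rV[R]_k => v 0 i)}.
  exact: coord_continuous.
exact: (cvgM (@cst_continuous _ _ (g 0 i) u) cu).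
Qed.

(** The two inequalities leave, along the direction g1 - g2, a slope |g1 - g2|
    that is at most every positive e. *)
Lemma frechet_subgrad_eq h x g1 g2 : frechet_subgrad h x g1 ->
  frechet_subgrad (fun y => - h y) x (- g2) -> g1 = g2.
Proof.
move=> sub1 sub2; apply/eqP; rewrite -subr_eq0 -normr_le0.
apply/ler_addgt0Pl => e e0; rewrite addr0; set d := g1 - g2.
have e2 : 0 < e / 2 by rewrite divr_gt0.
have near2 : \forall y \near x, h x + dot g1 (y - x) - e / 2 * `|y - x| <= h y /\
    - h x + dot (- g2) (y - x) - e / 2 * `|y - x| <= - h y.
  by near=> y; split; near: y; [exact: sub1|exact: sub2].
have [t t0] := near_ray d near2.
rewrite /= (addrC x) addrK normrZ gtr0_norm// !dotZr dotNl => -[h1 h2].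
have h3 : t * dot d d <= e * (t * `|d|) by rewrite {2}/d dotBl; lra.
move: h3; rewrite mulrCA ler_pM2l// => h3.
have [->|d0] := eqVneq `|d| 0; first exact: ltW.
have d_gt0 : 0 < `|d| by rewrite lt_neqAle eq_sym d0 normr_ge0.
rewrite -(ler_pM2r d_gt0) (le_trans _ h3)// -expr2; exact: dotuu_ge.
Unshelve. all: by end_near. Qed.

Lemma frechet_subgrad_differentiable h x g : frechet_subgrad h x g ->
  frechet_subgrad (fun y => - h y) x (- g) ->
  differentiable h x /\ grad h x = g.
Proof.
move=> sub1 sub2.
have [|dh dE] := differentiable_estimate (f := h) (@dot_linear_continuous g) (x := x).
  move=> e e0; near=> y; rewrite ler_norml; apply/andP; split.
    have : h x + dot g (y - x) - e * `|y - x| <= h y by near: y; exact: sub1.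
    rewrite /= /dot_linear; lra.
  have : - h x + dot (- g) (y - x) - e * `|y - x| <= - h y by near: y; exact: sub2.
  rewrite dotNl /= /dot_linear; lra.
split => //; apply/rowP => i; rewrite mxE deriveE// dE.
exact: dot_delta.
Unshelve. all: by end_near. Qed.

Lemma derive_grad h x v : differentiable h x -> 'D_v h x = dot (grad h x) v.
Proof.
move=> dh; rewrite deriveE// {1}(row_sum_delta v) linear_sum; apply: eq_bigr => i _.
by rewrite linearZ/= mxE deriveE// mulrC.
Qed.

Lemma differentiable_frechet h x : differentiable h x ->
  frechet_subgrad h x (grad h x) /\ frechet_subgrad (fun y => - h y) x (- grad h x).
Proof.
move=> dh.
have dE v : 'd h x v = dot (grad h x) v by rewrite -derive_grad// deriveE.
have near2 e : 0 < e ->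
    \forall y \near x, `|h y - h x - dot (grad h x) (y - x)| <= e * `|y - x|.
  move=> e0; have := differentiable_estimateV dh e0.
  by apply: filterS => y; rewrite dE.
split => e e0; near=> y.
  have : `|h y - h x - dot (grad h x) (y - x)| <= e * `|y - x|.
    by near: y; exact: near2.
  by rewrite ler_norml => /andP[]; lra.
have : `|h y - h x - dot (grad h x) (y - x)| <= e * `|y - x|.
  by near: y; exact: near2.
by rewrite ler_norml => /andP[]; rewrite dotNl; lra.
Unshelve. all: by end_near. Qed.

Lemma norm_grad_le h x L : 0 <= L -> differentiable h x ->
  (\forall y \near x, `|h y - h x| <= L * `|y - x|) -> `|grad h x| <= L.
Proof.
move=> L0 /differentiable_frechet[sub1 sub2] hL.
apply: normr_le_coord => // i; rewrite -dot_delta; set v := delta_mx 0 i.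
have v1 : `|v| <= 1.
  apply: normr_le_coord => // j; rewrite mxE eqxx/=.
  by case: (j == i); rewrite ?normr1 ?normr0.
apply/ler_addgt0Pr => e e0.
have near3 : \forall y \near x, [/\ `|h y - h x| <= L * `|y - x|,
    h x + dot (grad h x) (y - x) - e * `|y - x| <= h y &
    - h x + dot (- grad h x) (y - x) - e * `|y - x| <= - h y].
  by near=> y; split; near: y; [exact: hL|exact: sub1|exact: sub2].
have [t t0] := near_ray v near3.
rewrite /= (addrC x) addrK normrZ (gtr0_norm t0) !dotZr dotNl mulrN.
rewrite ler_norml => -[/andP[h1 h2] h3 h4].
rewrite ler_norml; set D := dot _ _ in h3 h4 *.
have tv : (L + e) * (t * `|v|) <= (L + e) * t.
  by apply: ler_wpM2l; [rewrite addr_ge0// ltW|rewrite -[leRHS]mulr1 ler_wpM2l// ltW].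
by apply/andP; split; rewrite -(ler_pM2l t0); lra.
Unshelve. all: by end_near. Qed.

End FrechetSubgradient.

Lemma lipschitz_within_continuous {R : realType} {k : nat} (A : set 'rV[R]_k)
    (h : 'rV[R]_k -> R) L : 0 <= L ->
  (forall y z, A y -> A z -> `|h y - h z| <= L * `|y - z|) ->
  {within A, continuous h}.
Proof.
move=> L0 hL; apply/subspace_continuousP => x Ax.
apply/cvgrPdist_le => e e0; rewrite near_withinE; apply/near_normP.
exists (e / (L + 1)) => [|y xy Ay]; first by rewrite divr_gt0// ltr_wpDl.
rewrite (le_trans (hL _ _ Ax Ay))// distrC.
move: xy; rewrite ltr_pdivlMr ?ltr_wpDl// => /ltW; apply: le_trans.
by rewrite mulrC ler_wpM2l// lerDl.
Qed.

Section ClarkeSubdifferential.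
Context {R : realType} {k : nat}.
Variables (h : 'rV[R]_k -> R) (x0 : 'rV[R]_k) (r0 L : R).
Hypotheses (r0_gt0 : 0 < r0) (L_ge0 : 0 <= L).
Hypothesis h_lip : forall y z, `|y - x0| < r0 -> `|z - x0| < r0 ->
  `|h y - h z| <= L * `|y - z|.

Lemma grad_near_bound z : `|z - x0| < r0 -> differentiable h z -> `|grad h z| <= L.
Proof.
move=> zr dz; apply: norm_grad_le => //.
apply/near_normP; exists (r0 - `|z - x0|); first by rewrite subr_gt0.
move=> y yz; apply: h_lip => //.
by rewrite -(subrK z y) -addrA (le_lt_trans (ler_normD _ _))// -ltrBrDr.
Qed.

Variable xi : 'rV[R]_k -> 'rV[R]_k.
Hypothesis xi_sub : forall z, `|z - x0| < r0 -> frechet_subgrad h z (xi z).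

(** A point where the difference of h and a steep paraboloid is maximal is one
    where h has a smooth upper bound, hence a supergradient. *)
Lemma differentiable_dense y0 r : 0 < r -> `|y0 - x0| + r < r0 ->
  exists z, [/\ `|z - y0| < r, differentiable h z & grad h z = xi z].
Proof.
move=> r_gt0 y0r.
(* With this slope a gain of at most L |z - y0| in h cannot pay for the paraboloid
   on the sphere of radius r, so the maximum is reached inside. *)
pose c := (L + 1) / r.
have c_gt0 : 0 < c by rewrite divr_gt0// ltr_wpDl.
pose B := [set y | `|y - y0| <= r].
have Br0 y : B y -> `|y - x0| < r0.
  move=> By; rewrite -(subrK y0 y) -addrA (le_lt_trans (ler_normD _ _))//.
  by rewrite (le_lt_trans _ y0r)// [leRHS]addrC lerD2r.
pose F y := h y - c * dot (y - y0) (y - y0).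
have F_cont : {within B, continuous F}.
  have h_cont : {within B, continuous h}.
    by apply: lipschitz_within_continuous L_ge0 _ => y z /Br0 yr /Br0; exact: h_lip.
  have d_cont : {within B, continuous (fun y => c * dot (y - y0) (y - y0))}.
    by apply: continuous_subspaceT => y; exact: paraboloid_continuous.
  rewrite (_ : F = h \- (fun y => c * dot (y - y0) (y - y0)))//.
  by move=> y; apply: (@continuousB _ R^o); [exact: h_cont|exact: d_cont].
have B0 : B !=set0 by exists y0; rewrite /B/= subrr normr0 ltW.
have [z /set_mem Bz zmax] := EVT_max_rV B0 (@compact_normB_le R k y0 r) F_cont.
have zmaxB y : B y -> F y <= F z by move=> /mem_set /zmax.
have By0 : B y0 by rewrite /B/= subrr normr0 ltW.
have zr : `|z - y0| < r.
  have := zmaxB _ By0; rewrite /F subrr dot0r mulr0 subr0.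
  have := h_lip (Br0 _ Bz) (Br0 _ By0); rewrite ler_norml => /andP[_ h1] h2.
  have := dotuu_ge (z - y0); rewrite -(ler_pM2l c_gt0) => h3.
  have h4 : c * `|z - y0| ^+ 2 <= L * `|z - y0| by lra.
  have [->//|zn] := eqVneq `|z - y0| 0.
  have z_gt0 : 0 < `|z - y0| by rewrite lt_neqAle eq_sym zn normr_ge0.
  move: h4; rewrite expr2 mulrA ler_pM2r// /c mulrAC ler_pdivrMr// => h4.
  rewrite ltNge; apply/negP => h5; have := ler_wpM2l L_ge0 h5; lra.
pose zeta := (2 * c) *: (z - y0).
have sub2 : frechet_subgrad (fun y => - h y) z (- zeta).
  move=> e e0; near=> y.
  have yB : B y.
    rewrite /B/=; near: y; apply/near_normP; exists (r - `|z - y0|).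
      by rewrite subr_gt0.
    move=> y yz; rewrite -(subrK z y) -addrA (le_trans (ler_normD _ _))//.
    by rewrite -lerBrDr ltW.
  have ye : c * (k%:R * `|y - z|) <= e.
    near: y; apply/near_normP; exists (e / (c * k%:R + 1)) => [|y yz].
      by rewrite divr_gt0// ltr_wpDl// mulr_ge0// ltW.
    move: yz; rewrite ltr_pdivlMr; last by rewrite ltr_wpDl// mulr_ge0// ltW.
    move=> /ltW; apply: le_trans.
    by rewrite mulrA [leRHS]mulrC mulrDl mul1r lerDl.
  have := zmaxB _ yB; rewrite /F.
  have -> : y - y0 = (z - y0) + (y - z) by rewrite [RHS]addrC addrA subrK.
  rewrite dotDD dotNl dotZl => h1.
  have h2 : c * dot (y - z) (y - z) <= e * `|y - z|.
    have := le_trans (ler_norm _) (ler_norm_dot (y - z) (y - z)).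
    rewrite mulrA => /(ler_wpM2l (ltW c_gt0))/le_trans; apply.
    by rewrite [leLHS]mulrA ler_wpM2r.
  lra.
have xiE := frechet_subgrad_eq (xi_sub (Br0 _ Bz)) sub2.
rewrite -xiE in sub2.
have [dz gz] := frechet_subgrad_differentiable (xi_sub (Br0 _ Bz)) sub2.
by exists z.
Unshelve. all: by end_near. Qed.

Hypothesis xi_unif : forall e, 0 < e -> exists2 r, 0 < r &
  forall y z, `|y - x0| < r -> `|z - x0| < r ->
    h z + dot (xi z) (y - z) - e * `|y - z| <= h y.

(** Walk from x0 a short step t in the direction d, then a much shorter one to
    a point z of differentiability.  The uniform subgradient inequality from z
    to z - t d, which is almost x0, bounds the slope of h at z from below by
    the slope of h from x0 to x0 + t d, thus by the slope of g. *)
Lemma gradient_slope_ge g d e : frechet_subgrad h x0 g -> 0 < e ->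
  exists z, [/\ `|z - x0| < e, differentiable h z &
    dot g d - e <= dot (grad h z) d].
Proof.
move=> g_sub e_gt0; pose N := `|d| + 1.
have N_gt0 : 0 < N by rewrite ltr_wpDl.
have dN : `|d| <= N by rewrite lerDl.
(* The loss e is shared: eta bounds the errors of the two expansions, taken over
   steps of length at most t N, and q t bounds the distances from z to x0 + t d
   and from z - t d to x0. *)
pose eta := e / (4 * N); have eta_gt0 : 0 < eta by rewrite divr_gt0// mulr_gt0.
pose L' := L + 1; have L'_gt0 : 0 < L' by rewrite ltr_wpDl.
pose q := Num.min 1 (e / (4 * L')).
have q_gt0 : 0 < q by rewrite lt_min ltr01/= divr_gt0// mulr_gt0.
have q_le1 : q <= 1 by rewrite ge_min lexx.
have Lq : L * q <= e / 4.
  rewrite (@le_trans _ _ (L' * (e / (4 * L'))))//.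
    by apply: ler_pM => //; [exact: ltW|rewrite lerDl|rewrite ge_min lexx orbT].
  by rewrite le_eqVlt; apply/orP; left; apply/eqP; field; rewrite gt_eqF.
have [r1 r1_gt0 unif] := xi_unif eta_gt0.
have /near_normP[r2 r2_gt0 g_eta] := g_sub _ eta_gt0.
pose r := Num.min (Num.min r0 e) (Num.min r1 r2).
have r_gt0 : 0 < r by rewrite !lt_min r0_gt0 e_gt0 r1_gt0 r2_gt0.
pose t := r / (2 * (N + 1)).
have t_gt0 : 0 < t by rewrite divr_gt0// mulr_gt0// ltr_wpDl// ltW.
have tN : t * (N + 1) < r.
  rewrite /t invfM mulrA divfK; last by rewrite gt_eqF// ltr_wpDl// ltW.
  by rewrite ltr_pdivrMr// ltr_pMr// ltrDl.
have [r_r0 r_e r_r1 r_r2] : [/\ r <= r0, r <= e, r <= r1 & r <= r2].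
  by split; rewrite !ge_min lexx ?orbT.
pose y0 := x0 + t *: d.
have y0x0 : y0 - x0 = t *: d by rewrite /y0 addrC addKr.
have y0_norm : `|y0 - x0| <= t * N.
  by rewrite y0x0 normrZ gtr0_norm// ler_wpM2l// ltW.
have tq : t * q <= t by rewrite -[leRHS]mulr1 ler_wpM2l// ltW.
have [|z [zy0 dz gz]] := @differentiable_dense y0 (t * q) (mulr_gt0 t_gt0 q_gt0).
  by rewrite mulrDr mulr1 in tN; lra.
have zx0 : `|z - x0| < r.
  rewrite -(subrK y0 z) -addrA (le_lt_trans (ler_normD _ _))//.
  by rewrite mulrDr mulr1 in tN; lra.
pose y := z - t *: d.
have yx0 : `|y - x0| < t * q.
  rewrite (le_lt_trans _ zy0)// /y -y0x0 (_ : _ - _ = z - y0)//.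
  by rewrite -addrA -opprD subrK.
have tNt : t * q < r by rewrite mulrDr mulr1 in tN; nra.
exists z; split => //; first exact: lt_le_trans zx0 r_e.
rewrite gz -(ler_pM2l t_gt0).
have dtN : eta * (t * `|d|) <= eta * (t * N).
  by apply: (ler_wpM2l (ltW eta_gt0)); exact: (ler_wpM2l (ltW t_gt0)).
have h1 : h z - t * dot (xi z) d - eta * (t * N) <= h y.
  have := unif y z (lt_le_trans (lt_trans yx0 tNt) r_r1) (lt_le_trans zx0 r_r1).
  have -> : y - z = - (t *: d) by rewrite /y addrAC subrr add0r.
  rewrite normrN dotNr dotZr normrZ gtr0_norm//.
  by apply: le_trans; rewrite lerD2l lerN2.
have y0r : `|y0 - x0| < r by rewrite mulrDr mulr1 in tN; lra.
have h2 : h x0 + t * dot g d - eta * (t * N) <= h y0.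
  have := g_eta y0 (lt_le_trans y0r r_r2).
  rewrite y0x0 dotZr normrZ gtr0_norm//.
  by apply: le_trans; rewrite lerD2l lerN2.
have h3 : h y <= h x0 + L * (t * q).
  have := h_lip (lt_le_trans (lt_trans yx0 tNt) r_r0) (_ : `|x0 - x0| < r0).
  rewrite subrr normr0 => /(_ r0_gt0); rewrite ler_norml => /andP[_].
  by have := ler_wpM2l L_ge0 (ltW yx0); lra.
have h4 : h y0 <= h z + L * (t * q).
  have := h_lip (lt_le_trans y0r r_r0) (lt_le_trans zx0 r_r0).
  rewrite ler_norml distrC => /andP[_].
  by have := ler_wpM2l L_ge0 (ltW zy0); lra.
have h5 : eta * (t * N) = t * (e / 4).
  by rewrite /eta; field; rewrite gt_eqF.
have h6 : L * (t * q) <= t * (e / 4) by rewrite mulrCA ler_wpM2l// ltW.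
lra.
Qed.

Let K := [set l | forall e, 0 < e -> exists z,
  [/\ `|z - x0| < e, differentiable h z & `|grad h z - l| < e]].

Let K_clarke : convex_hull K `<=` clarke_subdiff h x0.
Proof.
move=> x Kx M [M_convex limM]; apply: Kx; split => // l lK; apply: limM.
have n_gt0 n : 0 < n.+1%:R^-1 :> R by rewrite invr_gt0.
pose z n := projT1 (cid (lK _ (n_gt0 n))).
have zP n := projT2 (cid (lK _ (n_gt0 n))).
exists z; split.
- apply/cvgrPdist_le => e e0; near=> n; have [/ltW zx _ _] := zP n.
  rewrite distrC (le_trans zx)// ltW//; near: n.
  exact: near_infty_natSinv_lt (PosNum e0).
- by move=> n; have [] := zP n.
- apply/cvgrPdist_le => e e0; near=> n; have [_ _ /ltW zx] := zP n.
  rewrite distrC (le_trans zx)// ltW//; near: n.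
  exact: near_infty_natSinv_lt (PosNum e0).
Unshelve. all: by end_near. Qed.

Let K_compact : compact K.
Proof.
apply: bounded_closed_compact.
  exists (L + 1); split; first by rewrite num_real.
  move=> M LM l lK /=; rewrite (le_trans _ (ltW LM))//.
  pose e := Num.min r0 1; have e0 : 0 < e by rewrite lt_min r0_gt0 ltr01.
  have [z [zx dz zl]] := lK _ e0.
  rewrite -[l](subKr (grad h z)) (le_trans (ler_normB _ _))// lerD//.
    by apply: grad_near_bound => //; rewrite (lt_le_trans zx)// ge_min lexx.
  by rewrite (le_trans (ltW zl))// ge_min lexx orbT.
move=> l lK e e0; have e2 : 0 < e / 2 by rewrite divr_gt0.
have [l' [lK' ll']] := lK _ (nbhsx_ballx l (e / 2) e2).
have [z [zx dz zl]] := lK' _ e2.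
exists z; split => //; first by rewrite (lt_trans zx)// ltr_pdivrMr// ltr_pMr// ltrDl.
move: ll'; rewrite -ball_normE/= distrC => ll'.
rewrite -(subrK l' (grad h z)) -addrA (le_lt_trans (ler_normD _ _))//; lra.
Qed.

(** Were g outside the hull of the compact set K of limiting gradients, some
    direction d would separate it strictly from K.  But [gradient_slope_ge] gives
    gradients at points tending to x0 with a slope along d asymptotically at least
    that of g, and these accumulate in K. *)
Theorem frechet_subgrad_clarke g :
  frechet_subgrad h x0 g -> clarke_subdiff h x0 g.
Proof.
move=> g_sub; apply: K_clarke; apply: (mem_convex_hull K_compact) => d.
have e_gt0 n : 0 < Num.min r0 n.+1%:R^-1 by rewrite lt_min r0_gt0 invr_gt0/=.
have sl n := gradient_slope_ge d g_sub (e_gt0 n).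
pose z n := projT1 (cid (sl n)).
have zP n := projT2 (cid (sl n)).
have gz_bound n : `|grad h (z n)| <= L.
  have [zx dz _] := zP n; apply: grad_near_bound => //.
  by rewrite (lt_le_trans zx)// ge_min lexx.
have [l lP] := bounded_cluster_value gz_bound.
have small e : 0 < e -> exists n,
    [/\ `|z n - x0| < e, `|grad h (z n) - l| < e & dot g d - e <= dot (grad h (z n)) d].
  move=> e0; have [N _ NP] := near_infty_natSinv_lt (PosNum e0).
  have [n Nn nl] := lP e e0 N; exists n; have [zx _ sz] := zP n.
  have re : Num.min r0 n.+1%:R^-1 < e by rewrite gt_min (NP n Nn) orbT.
  split => //; first exact: lt_trans zx re.
  by rewrite (le_trans _ sz)// lerD2l lerN2 ltW.
exists l => [e /small[n [zx zl _]]|].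
  by exists (z n); split => //; have [] := zP n.
apply/ler_addgt0Pr => e e0; pose c := k%:R * `|d| + 1.
have c0 : 0 < c by rewrite ltr_wpDl// mulr_ge0.
have [|n [_ zl sz]] := small (e / (2 * c)) _; first by rewrite divr_gt0// mulr_gt0.
have c1 : 1 <= c by rewrite lerDr mulr_ge0.
have := ler_norm_dot (grad h (z n) - l) d; rewrite dotBl ler_norml => /andP[_ h1].
have h2 : k%:R * (`|grad h (z n) - l| * `|d|) <= e / 2.
  rewrite mulrCA (@le_trans _ _ (e / (2 * c) * c))//.
    by rewrite ler_pM ?mulr_ge0// ?(ltW zl)// lerDl.
  by rewrite invfM mulrA divfK// gt_eqF.
have h3 : e / (2 * c) <= e / 2.
  by rewrite ler_pM2l// lef_pV2 ?posrE ?mulr_gt0// ler_pMr.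
lra.
Qed.

End ClarkeSubdifferential.

(** * Subgradients of a bounded convex function *)

Section LocallyConvex.
Context {R : realType} {k : nat}.
Variables (phi : 'rV[R]_k -> R) (c0 : 'rV[R]_k) (r m0 M0 : R).
Hypothesis r_gt0 : 0 < r.
Hypothesis phi_convex : forall x y t, `|x - c0| < r -> `|y - c0| < r ->
  0 <= t -> t <= 1 -> phi (t *: x + (1 - t) *: y) <= t * phi x + (1 - t) * phi y.
Hypothesis phi_ge : forall x, `|x - c0| < r -> m0 <= phi x.
Hypothesis phi_le : forall x, `|x - c0| < r -> phi x <= M0.
Implicit Types (x y z nu : 'rV[R]_k).

(** The inequality is required over the ball only: outside it the real function
    phi may stand for an infinite value. *)
Definition subgrad_near z nu :=
  forall x, `|x - c0| < r -> phi z + dot nu (x - z) <= phi x.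

Definition lip_const := (M0 - m0) / (r / 2).

Lemma lip_const_ge0 : 0 <= lip_const.
Proof.
have cr : `|c0 - c0| < r by rewrite subrr normr0.
by rewrite divr_ge0 ?subr_ge0 ?(le_trans (phi_ge cr) (phi_le cr))// divr_ge0// ltW.
Qed.

Lemma ball_half x : `|x - c0| < r / 2 -> `|x - c0| < r.
Proof. by move/lt_trans; apply; rewrite ltr_pdivrMr// ltr_pMr// ltrDl. Qed.

(** The convex function is below its chord over a segment prolonged by r / 2,
    whose slope is at most (M0 - m0) / (r / 2). *)
Lemma convex_lipschitz x y : `|x - c0| < r / 2 -> `|y - c0| < r / 2 ->
  `|phi x - phi y| <= lip_const * `|x - y|.
Proof.
suff one_sided x' y' : `|x' - c0| < r / 2 -> `|y' - c0| < r / 2 ->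
    phi y' - phi x' <= lip_const * `|x' - y'|.
  move=> xr yr; rewrite ler_norml; have := one_sided x y xr yr.
  have := one_sided y x yr xr; rewrite (distrC y) => h1 h2.
  by apply/andP; split; lra.
move=> xr yr; set s := r / 2 in xr yr *; set e := `|x' - y'|.
have s_gt0 : 0 < s by rewrite divr_gt0.
have [e0|en0] := eqVneq e 0.
  move/eqP: (e0); rewrite normr_eq0 subr_eq0 => /eqP ->.
  by rewrite e0 mulr0 subrr.
have e_gt0 : 0 < e by rewrite lt_neqAle eq_sym en0 normr_ge0.
have se_gt0 : 0 < s + e by rewrite addr_gt0.
(* z prolongs the segment from x' to y' by the length s, staying in the ball. *)
pose z := y' + (s / e) *: (y' - x').
have zr : `|z - c0| < r.
  rewrite /z addrAC (le_lt_trans (ler_normD _ _))// normrZ ger0_norm; last first.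
    by rewrite divr_ge0// ltW.
  by rewrite (distrC y' x') -/e divfK// [ltRHS]splitr ltrD2r.
have t0 : 0 <= s / (s + e) by rewrite divr_ge0// ltW.
have t1 : s / (s + e) <= 1 by rewrite ler_pdivrMr// mul1r lerDl ltW.
have yE : y' = (s / (s + e)) *: x' + (1 - s / (s + e)) *: z.
  apply/rowP => i; rewrite /z !mxE; field.
  by rewrite !gt_eqF.
have := phi_convex (ball_half xr) zr t0 t1; rewrite -yE => h1.
have h2 : phi z - phi x' <= M0 - m0.
  by have := phi_le zr; have := phi_ge (ball_half xr); lra.
have h3 : phi y' - phi x' <= (1 - s / (s + e)) * (phi z - phi x') by lra.
rewrite (le_trans h3)//.
have -> : 1 - s / (s + e) = e / (s + e) by field; rewrite gt_eqF.
have h4 : 0 <= M0 - m0.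
  by have := phi_le zr; have := phi_ge zr; lra.
rewrite (@le_trans _ _ (e / (s + e) * (M0 - m0)))//.
  by rewrite ler_wpM2l// divr_ge0// ltW.
have -> : lip_const * e = e / s * (M0 - m0).
  by rewrite /lip_const -/s; field; rewrite gt_eqF.
rewrite ler_wpM2r// ler_wpM2l ?(ltW e_gt0)//.
by rewrite lef_pV2 ?posrE// lerDl ltW.
Qed.

(** A step along the i-th axis, scaled to stay in the half ball, compares the
    i-th coordinate of nu with the Lipschitz constant. *)
Lemma subgrad_bound z nu : `|z - c0| < r / 2 -> subgrad_near z nu ->
  `|nu| <= lip_const.
Proof.
move=> zr nu_sub; apply: normr_le_coord lip_const_ge0 _ => i.
rewrite -dot_delta; set v := delta_mx 0 i.
have v1 : `|v| <= 1.
  apply: normr_le_coord => // j; rewrite mxE eqxx/=.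
  by case: (j == i); rewrite ?normr1 ?normr0.
pose s := (r / 2 - `|z - c0|) / 2.
have s_gt0 : 0 < s by rewrite divr_gt0// subr_gt0.
have side e : `|e| = 1 -> e * dot nu v <= lip_const.
  move=> e1; pose y := z + (s * e) *: v.
  have ney : `|y - z| <= s.
    rewrite /y (addrC z) addrK normrZ normrM e1 mulr1 gtr0_norm//.
    by rewrite -[leRHS]mulr1 ler_wpM2l// ltW.
  have yr : `|y - c0| < r / 2.
    rewrite -(subrK z y) -addrA (le_lt_trans (ler_normD _ _))//.
    by rewrite /s in ney s_gt0; lra.
  have := nu_sub y (ball_half yr); rewrite {1}/y (addrC z) addrK dotZr => h1.
  have := convex_lipschitz yr zr; rewrite ler_norml => /andP[_ h2].
  have := ler_wpM2l lip_const_ge0 ney => h3.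
  by rewrite -(ler_pM2l s_gt0); lra.
have := side 1 (normr1 _); have := side (-1) (normrN1 _).
by rewrite ler_norml => h1 h2; apply/andP; split; lra.
Qed.

(** The Lipschitz constant bounds the subgradients over the half ball, so they have
    a cluster value, and the subgradient inequality passes to the limit because
    phi is continuous. *)
Lemma subgrad_cluster (z nu : nat -> 'rV[R]_k) c :
  (forall n, `|z n - c0| < r / 2) -> (forall n, subgrad_near (z n) (nu n)) ->
  `|c - c0| < r / 2 -> (forall n, `|z n - c| <= n.+1%:R^-1) ->
  exists2 l, subgrad_near c l & forall e, 0 < e -> exists n, `|nu n - l| < e.
Proof.
move=> zr nu_sub cr zc; set L := lip_const; have L0 : 0 <= L := lip_const_ge0.
have nuL n : `|nu n| <= L by exact: subgrad_bound (zr n) (nu_sub n).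
have [l lP] := bounded_cluster_value nuL.
exists l; last by move=> e e0; have [n _ ?] := lP e e0 0%N; exists n.
move=> x xr; apply/ler_addgt0Pr => e e0.
pose C := L + k%:R * L + k%:R * `|x - c| + 1.
have C_gt0 : 0 < C by rewrite ltr_wpDl// !addr_ge0// mulr_ge0.
have eC : 0 < e / C by rewrite divr_gt0.
have [N _ NP] := near_infty_natSinv_lt (PosNum eC).
have [n Nn nl] := lP _ eC N.
have zn : `|z n - c| <= e / C by rewrite (le_trans (zc n))// ltW//; exact: NP.
have h1 := nu_sub n x xr.
have := convex_lipschitz cr (zr n); rewrite -/L ler_norml distrC => /andP[_ h2].
have h3 : dot l (x - c) - dot (nu n) (x - z n) <=
    k%:R * `|nu n - l| * `|x - c| + k%:R * L * `|z n - c|.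
  have -> : dot l (x - c) - dot (nu n) (x - z n) =
      - dot (nu n - l) (x - c) + dot (nu n) (z n - c).
    by rewrite !(dotBl, dotBr); ring.
  apply: lerD.
    rewrite -normrN in nl; rewrite -mulrA (le_trans (ler_norm _))// normrN.
    exact: ler_norm_dot.
  rewrite -mulrA (le_trans (ler_norm _))// (le_trans (ler_norm_dot _ _))//.
  by rewrite ler_wpM2l// ler_wpM2r.
have h4 : L * `|z n - c| <= L * (e / C) by rewrite ler_wpM2l.
have h5 : k%:R * L * `|z n - c| <= k%:R * L * (e / C).
  by apply: ler_wpM2l => //; exact: mulr_ge0.
have h6 : k%:R * `|nu n - l| * `|x - c| <= k%:R * `|x - c| * (e / C).
  by rewrite mulrAC; apply: ler_wpM2l (ltW nl); exact: mulr_ge0.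
have h7 : (L + k%:R * L + k%:R * `|x - c| + 1) * (e / C) = e.
  by rewrite -/C; field; rewrite gt_eqF.
lra.
Qed.

(** Minimising phi plus a steep paraboloid centred at c gives, at the minimiser,
    a subgradient of phi; the minimisers tend to c as the paraboloid narrows. *)
Lemma subgrad_dense c s : `|c - c0| + s < r / 2 -> 0 < s ->
  exists z nu, `|z - c| <= s /\ subgrad_near z nu.
Proof.
move=> csr s_gt0; have L0 : 0 <= lip_const := lip_const_ge0; set L := lip_const in L0.
pose K := (L + 1) / s; have K_gt0 : 0 < K by rewrite divr_gt0// ltr_wpDl.
pose B := [set y | `|y - c| <= s].
have Br y : B y -> `|y - c0| < r / 2.
  move=> By; rewrite -(subrK c y) -addrA (le_lt_trans (ler_normD _ _))//.
  by rewrite (le_lt_trans _ csr)// [leRHS]addrC lerD2r.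
pose F y := phi y + K * dot (y - c) (y - c).
have F_cont : {within B, continuous F}.
  have phi_cont : {within B, continuous phi}.
    by apply: lipschitz_within_continuous L0 _ => y z /Br yr /Br; exact: convex_lipschitz.
  have d_cont : {within B, continuous (fun y => K * dot (y - c) (y - c))}.
    by apply: continuous_subspaceT => y; exact: paraboloid_continuous.
  rewrite (_ : F = phi \+ (fun y => K * dot (y - c) (y - c)))//.
  by move=> y; apply: (@continuousD _ R^o); [exact: phi_cont|exact: d_cont].
have Bc : B c by rewrite /B/= subrr normr0 ltW.
have [z /set_mem Bz zmin] :=
  EVT_min_rV (ex_intro _ _ Bc) (@compact_normB_le R k c s) F_cont.
have zminB y : B y -> F z <= F y by move=> /mem_set /zmin.
have zs : `|z - c| < s.
  have := zminB _ Bc; rewrite /F subrr dot0r mulr0 addr0.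
  have := convex_lipschitz (Br _ Bz) (Br _ Bc); rewrite -/L ler_norml => /andP[h1 _] h2.
  have := dotuu_ge (z - c); rewrite -(ler_pM2l K_gt0) => h3.
  have h4 : K * `|z - c| ^+ 2 <= L * `|z - c| by lra.
  have [->//|zn] := eqVneq `|z - c| 0.
  have z_gt0 : 0 < `|z - c| by rewrite lt_neqAle eq_sym zn normr_ge0.
  move: h4; rewrite expr2 mulrA ler_pM2r// /K mulrAC ler_pdivrMr// => h4.
  rewrite ltNge; apply/negP => h5; have := ler_wpM2l L0 h5; lra.
exists z, (- (2 * K) *: (z - c)); split; first exact: ltW.
move=> x xr; set D := dot (x - z) (x - z).
have D0 : 0 <= D by rewrite (le_trans _ (dotuu_ge _))// sqr_ge0.
apply/ler_addgt0Pr => e e_gt0.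
pose N := `|x - z| + 1; have N_gt0 : 0 < N by rewrite ltr_wpDl.
pose t := Num.min (Num.min 1 ((s - `|z - c|) / N)) (e / (K * D + 1)).
have KD : 0 < K * D + 1 by rewrite ltr_wpDl// mulr_ge0// ltW.
have t_gt0 : 0 < t by rewrite !lt_min ltr01/= !divr_gt0// subr_gt0.
have [t1 ts te] : [/\ t <= 1, t <= (s - `|z - c|) / N & t <= e / (K * D + 1)].
  by split; rewrite !ge_min lexx ?orbT.
pose y := t *: x + (1 - t) *: z.
have yz : y - z = t *: (x - z) by apply/rowP => i; rewrite !mxE; ring.
have By : B y.
  rewrite /B/= -(subrK z y) -addrA (le_trans (ler_normD _ _))// yz normrZ gtr0_norm//.
  rewrite -lerBrDr; move: ts; rewrite ler_pdivlMr//; apply: le_trans.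
  by rewrite ler_wpM2l ?(ltW t_gt0)// lerDl.
have h1 := zminB _ By.
have h2 := phi_convex xr (ball_half (Br _ Bz)) (ltW t_gt0) t1.
have yc : y - c = (z - c) + t *: (x - z) by rewrite -yz [RHS]addrC addrA subrK.
move: h1; rewrite /F yc (dotDD (z - c)) !dotZr !dotZl -/D -/y => h1.
have h3 : t * (K * D) <= e.
  move: te; rewrite ler_pdivlMr//; apply: le_trans.
  by rewrite ler_wpM2l ?(ltW t_gt0)// lerDl.
have h4 : t * phi z <= t * (phi x + K * 2 * dot (z - c) (x - z) + t * (K * D)).
  by rewrite -/y in h2; lra.
move: h4; rewrite ler_pM2l// => h4; lra.
Qed.

(** Subgradients at minimisers tending to c accumulate at one at c. *)
Lemma subgrad_exists c : `|c - c0| < r / 2 -> exists nu, subgrad_near c nu.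
Proof.
move=> cr; pose s := (r / 2 - `|c - c0|) / 2.
have s_gt0 : 0 < s by rewrite divr_gt0// subr_gt0.
pose sn n := Num.min s n.+1%:R^-1.
have sn_gt0 n : 0 < sn n by rewrite lt_min s_gt0 invr_gt0/=.
have sn_r n : `|c - c0| + sn n < r / 2.
  have : sn n <= s by rewrite ge_min lexx.
  by rewrite /s in s_gt0 *; lra.
have ex n := subgrad_dense (sn_r n) (sn_gt0 n).
pose z n := projT1 (cid (ex n)); pose nu n := projT1 (cid (projT2 (cid (ex n)))).
have zP n : `|z n - c| <= sn n /\ subgrad_near (z n) (nu n).
  exact: projT2 (cid (projT2 (cid (ex n)))).
have zr n : `|z n - c0| < r / 2.
  rewrite -(subrK c (z n)) -addrA (le_lt_trans (ler_normD _ _))//.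
  by rewrite (le_lt_trans _ (sn_r n))// [leRHS]addrC lerD2r (zP n).1.
have [|l l_sub _] := subgrad_cluster zr (fun n => (zP n).2) cr.
  by move=> n; rewrite (le_trans (zP n).1)// ge_min lexx orbT.
by exists l.
Qed.

(** Otherwise subgradients at points tending to c would accumulate at a
    subgradient at c other than mu. *)
Lemma subgrad_unique_continuous c mu e : `|c - c0| < r / 2 ->
  (forall nu, subgrad_near c nu -> nu = mu) -> 0 < e ->
  exists2 d, 0 < d & forall z nu, `|z - c| < d -> subgrad_near z nu -> `|nu - mu| < e.
Proof.
move=> cr mu_uniq e_gt0; apply: contrapT => no_d.
pose s := r / 2 - `|c - c0|; have s_gt0 : 0 < s by rewrite subr_gt0.
have ex n : exists q : 'rV[R]_k * 'rV[R]_k,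
    [/\ `|q.1 - c| < Num.min s n.+1%:R^-1, subgrad_near q.1 q.2 & e <= `|q.2 - mu|].
  apply: contrapT => no_q; apply: no_d; exists (Num.min s n.+1%:R^-1).
    by rewrite lt_min s_gt0 invr_gt0/=.
  move=> z nu zc nu_sub; rewrite ltNge; apply/negP => enu.
  by apply: no_q; exists (z, nu).
pose q n := projT1 (cid (ex n)); have qP n := projT2 (cid (ex n)).
have zr n : `|(q n).1 - c0| < r / 2.
  have [zc _ _] := qP n; rewrite -(subrK c (q n).1) -addrA.
  rewrite (le_lt_trans (ler_normD _ _))//.
  by rewrite -ltrBrDr (lt_le_trans zc)// ge_min lexx.
have [||l l_sub lP] := @subgrad_cluster (fun n => (q n).1) (fun n => (q n).2) c zr _ cr.
- by move=> n; have [] := qP n.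
- by move=> n; have [/ltW zc _ _] := qP n; rewrite (le_trans zc)// ge_min lexx orbT.
have [n] := lP e e_gt0; rewrite (mu_uniq l l_sub) ltNge; have [_ _ ->] := qP n.
by [].
Qed.

End LocallyConvex.

(** * Convex functions of a C1 map *)

Section StrictDifferentiability.
Context {R : realType} {p : nat}.
Implicit Types (f : 'rV[R]_p -> R) (x y z v : 'rV[R]_p).

Lemma is_derive_line f z v t : differentiable f (z + t *: v) ->
  is_derive t 1 (fun t => f (z + t *: v)) (dot (grad f (z + t *: v)) v).
Proof.
move=> df; rewrite -derive_grad//.
have qE : (fun h => h^-1 *: (((fun t => f (z + t *: v)) \o shift t) (h *: 1) -
      f (z + t *: v))) =
    (fun h => h^-1 *: ((f \o shift (z + t *: v)) (h *: v) - f (z + t *: v))).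
  apply/funext => h /=; congr (_ *: (f _ - _)).
  by rewrite [h%:A]mulr1 scalerDl addrCA.
by split; [rewrite /derivable qE; exact: diff_derivable|rewrite /derive qE].
Qed.

Lemma mean_value_segment f y z :
  (forall t : R, 0 <= t <= 1 -> differentiable f (z + t *: (y - z))) ->
  exists2 t : R, 0 <= t <= 1 & f y - f z = dot (grad f (z + t *: (y - z))) (y - z).
Proof.
move=> df; pose F t := f (z + t *: (y - z)).
pose dF (t : R) := dot (grad f (z + t *: (y - z))) (y - z).
have FdF (t : R) : 0 <= t <= 1 -> is_derive t 1 F (dF t).
  by move=> t01; exact: is_derive_line (df t t01).
have [t||t t01] := @MVT_segment R F dF 0 1 ler01.
- by rewrite in_itv/= => /andP[t0 t1]; apply: FdF; rewrite !ltW.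
- by apply: derivable_within_continuous => t; rewrite in_itv => /FdF[].
rewrite /F scale1r (addrC z) subrK scale0r addr0 subr0 mulr1 => fE.
by exists t => //; move: t01; rewrite in_itv.
Qed.

(** The mean value theorem moves the gradient to a point of the segment, where
    it is close to the gradient at z because both are close to that at x0. *)
Lemma strict_differentiability f x0 e : (\forall z \near x0, differentiable f z) ->
  {for x0, continuous (grad f)} -> 0 < e ->
  \forall r \near 0^'+, forall y z, `|y - x0| < r -> `|z - x0| < r ->
    `|f y - f z - dot (grad f z) (y - z)| <= e * `|y - z|.
Proof.
move=> /near_normP[r1 r1_gt0 df] gc e_gt0.
pose e' := e / (2 * p%:R + 1).
have p_gt0 : 0 < 2 * p%:R + 1 :> R by rewrite ltr_wpDl.
have e'_gt0 : 0 < e' by rewrite divr_gt0.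
have /near_normP[r2 r2_gt0 gce] : \forall z \near x0, `|grad f x0 - grad f z| <= e'.
  by move/cvgrPdist_le : gc; apply.
near=> r => y z yr zr.
have [rr1 rr2] : r <= r1 /\ r <= r2 by split; near: r; exact: nbhs_right_le.
have seg (t : R) : 0 <= t <= 1 -> `|z + t *: (y - z) - x0| < r.
  move=> /andP[t0 t1].
  have -> : z + t *: (y - z) - x0 = t *: (y - x0) + (1 - t) *: (z - x0).
    by apply/rowP => i; rewrite !mxE; ring.
  have t'0 : 0 <= 1 - t by rewrite subr_ge0.
  rewrite (le_lt_trans (ler_normD _ _))// !normrZ !ger0_norm//.
  have [yz|zy] := leP `|y - x0| `|z - x0|.
    by have := ler_wpM2l t0 yz; lra.
  by have := ler_wpM2l t'0 (ltW zy); lra.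
have [t /seg tr ->] : exists2 t : R, 0 <= t <= 1 &
    f y - f z = dot (grad f (z + t *: (y - z))) (y - z).
  by apply: mean_value_segment => t /seg tr; apply: df; exact: lt_le_trans tr rr1.
rewrite -dotBl (le_trans (ler_norm_dot _ _))// mulrA ler_wpM2r//.
have h1 := gce _ (lt_le_trans tr rr2); have h2 := gce _ (lt_le_trans zr rr2).
have h3 : `|grad f (z + t *: (y - z)) - grad f z| <= 2 * e'.
  rewrite distrC in h1; rewrite -(subrK (grad f x0) (grad f (z + t *: (y - z)))) -addrA.
  by rewrite (le_trans (ler_normD _ _))// mulrDl mul1r lerD.
have h4 : p%:R * (2 * e') + e' = e by rewrite /e'; field; rewrite gt_eqF.
by have := ler_wpM2l (ler0n R p) h3; lra.
Unshelve. all: by end_near. Qed.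

End StrictDifferentiability.

Lemma near_forall {R : realType} {p m : nat} (P : 'I_m -> 'rV[R]_p -> Prop)
    (x : 'rV[R]_p) : (forall j, \forall y \near x, P j y) ->
  \forall y \near x, forall j, P j y.
Proof.
move=> hP; have F : Filter (nbhs x) by exact: nbhs_filter.
exact: (@filter_forall _ _ (fun j y => P j y) (nbhs x) F hP).
Qed.

Section ConvexComposite.
Context {R : realType} {p m : nat}.
Variables (phi : 'rV[R]_m -> R) (S : 'I_m -> 'rV[R]_p -> R) (x0 : 'rV[R]_p).
Variables (r m0 M0 : R).
Let Sv y : 'rV[R]_m := \row_j S j y.
Let c0 := Sv x0.
Hypothesis r_gt0 : 0 < r.
Hypothesis phi_convex : forall x y t, `|x - c0| < r -> `|y - c0| < r ->
  0 <= t -> t <= 1 -> phi (t *: x + (1 - t) *: y) <= t * phi x + (1 - t) * phi y.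
Hypothesis phi_ge : forall x, `|x - c0| < r -> m0 <= phi x.
Hypothesis phi_le : forall x, `|x - c0| < r -> phi x <= M0.
Hypothesis S_diff : \forall z \near x0, forall j, differentiable (S j) z.
Hypothesis S_C1 : forall j, {for x0, continuous (grad (S j))}.
Variable h : 'rV[R]_p -> R.
Hypothesis h_eq : \forall y \near x0, h y = phi (Sv y).

Let L := lip_const r m0 M0.
Let L_ge0 : 0 <= L. Proof. exact: (lip_const_ge0 r_gt0 phi_ge phi_le). Qed.
(* A Lipschitz constant of Sv near x0, where each gradient exceeds its value at
   x0 by at most 1 and the linear approximation has error at most 1. *)
Let LS := \sum_j (p%:R * `|grad (S j) x0| + p%:R + 1).
Let LS_ge0 : 0 <= LS.
Proof. by apply: sumr_ge0 => j _; rewrite !addr_ge0// mulr_ge0. Qed.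

Implicit Types (nu mu : 'rV[R]_m) (y z : 'rV[R]_p).

(* The transposed Jacobian of S at z applied to nu. *)
Let pull nu z : 'rV[R]_p := \sum_j nu 0 j *: grad (S j) z.

Lemma near_image_ball : \forall y \near x0, `|Sv y - c0| < r.
Proof.
have near_j j : \forall y \near x0, `|S j x0 - S j y| <= r / 2.
  have dj : differentiable (S j) x0 by exact: (nbhs_singleton S_diff).
  by move/cvgrPdist_le : (differentiable_continuous dj); apply; rewrite divr_gt0.
apply: filterS (near_forall near_j) => y yr.
apply: (@le_lt_trans _ _ (r / 2)); last by rewrite ltr_pdivrMr// ltr_pMr// ltrDl.
apply: normr_le_coord => [|j]; first by rewrite divr_ge0// ltW.
by rewrite !mxE distrC.
Qed.

Let pull_estimate nu y z e : `|nu| <= L -> 0 <= e ->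
  (forall j, `|S j y - S j z - dot (grad (S j) z) (y - z)| <= e * `|y - z|) ->
  `|dot nu (Sv y - Sv z) - dot (pull nu z) (y - z)| <= m%:R * L * e * `|y - z|.
Proof.
move=> nuL e0 Sjyz; rewrite dot_sumZl /dot -sumrB.
rewrite (le_trans (ler_norm_sum _ _ _))//.
have -> : m%:R * L * e * `|y - z| = \sum_(j < m) L * (e * `|y - z|).
  by rewrite sumr_const card_ord -[RHS]mulr_natl !mulrA.
apply: ler_sum => j _; rewrite !mxE -mulrBr normrM.
by apply: ler_pM => //; rewrite (le_trans (normr_coord _ _)).
Qed.

Let strict e : 0 < e -> exists2 d, 0 < d & forall y z, `|y - x0| < d -> `|z - x0| < d ->
  forall j, `|S j y - S j z - dot (grad (S j) z) (y - z)| <= e * `|y - z|.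
Proof.
move=> e0.
have : \forall d \near 0^'+, 0 < d /\ forall j y z, `|y - x0| < d -> `|z - x0| < d ->
    `|S j y - S j z - dot (grad (S j) z) (y - z)| <= e * `|y - z|.
  near=> d; split => //; near: d; apply: filter_forall => j.
  apply: strict_differentiability => //.
  by apply: filterS S_diff => z; exact.
move=> /filter_ex[d [d0 dP]]; exists d => // y z yd zd j; exact: dP.
Unshelve. all: by end_near. Qed.

Let ball_data : exists d, [/\ 0 < d,
  forall y, `|y - x0| < d -> [/\ `|Sv y - c0| < r / 2, h y = phi (Sv y) &
     forall j, differentiable (S j) y] &
  forall y z, `|y - x0| < d -> `|z - x0| < d -> `|Sv y - Sv z| <= LS * `|y - z|].
Proof.
have [d1 d1_gt0 d1P] := strict ltr01.
have /near_normP[d2 d2_gt0 d2P] : \forall y \near x0,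
    h y = phi (Sv y) /\ forall j, differentiable (S j) y.
  by near=> y; split; near: y.
have grad_near j : \forall y \near x0, `|grad (S j) x0 - grad (S j) y| <= 1.
  by move/cvgrPdist_le : (S_C1 (j := j)); apply.
have /near_normP[d3 d3_gt0 d3P] := near_forall grad_near.
pose d := Num.min (Num.min d1 (r / 2 / (LS + 1))) (Num.min d2 d3).
have LS1 : 0 < LS + 1 by rewrite ltr_wpDl.
have d_gt0 : 0 < d by rewrite !lt_min d1_gt0 d2_gt0 d3_gt0 !divr_gt0.
have [dd1 ddr dd2 dd3] : [/\ d <= d1, d <= r / 2 / (LS + 1), d <= d2 & d <= d3].
  by split; rewrite !ge_min lexx ?orbT.
have S_lip y z : `|y - x0| < d -> `|z - x0| < d -> `|Sv y - Sv z| <= LS * `|y - z|.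
  move=> yd zd; apply: normr_le_coord => [|j]; first exact: mulr_ge0.
  rewrite !mxE; have h1 := d1P y z (lt_le_trans yd dd1) (lt_le_trans zd dd1) j.
  have h2 := d3P z (lt_le_trans zd dd3) j.
  have h3 : `|grad (S j) z| <= `|grad (S j) x0| + 1.
    rewrite -(subKr (grad (S j) x0) (grad (S j) z)).
    by rewrite (le_trans (ler_normB _ _))// lerD2l.
  have h4 := ler_norm_dot (grad (S j) z) (y - z).
  have h5 := ler_wpM2l (ler0n R p) (ler_wpM2r (normr_ge0 (y - z)) h3).
  rewrite -(subrK (dot (grad (S j) z) (y - z)) (S j y - S j z)).
  rewrite (le_trans (ler_normD _ _))//.
  have h6 : (p%:R * `|grad (S j) x0| + p%:R + 1) <= LS.
    by rewrite /LS (bigD1 j)//= lerDl sumr_ge0// => i _; rewrite !addr_ge0// mulr_ge0.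
  have h7 := ler_wpM2r (normr_ge0 (y - z)) h6.
  lra.
exists d; split => // y yd; have [hy dy] := d2P y (lt_le_trans yd dd2); split => //.
have x0d : `|x0 - x0| < d by rewrite subrr normr0.
rewrite (le_lt_trans (S_lip _ _ yd x0d))//.
move: (lt_le_trans yd ddr); rewrite ltr_pdivlMr//; apply: le_lt_trans.
by rewrite mulrC ler_wpM2l// lerDl.
Unshelve. all: by end_near. Qed.

Let frechet_pull z nu d : 0 < d ->
  (forall y, `|y - x0| < d -> [/\ `|Sv y - c0| < r / 2, h y = phi (Sv y) &
     forall j, differentiable (S j) y]) ->
  `|z - x0| < d -> subgrad_near phi c0 r (Sv z) nu -> frechet_subgrad h z (pull nu z).
Proof.
move=> d_gt0 dP zd nu_sub e e_gt0; have [Szr hz dz] := dP z zd.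
have nuL := subgrad_bound r_gt0 phi_convex phi_ge phi_le Szr nu_sub.
pose e' := e / (m%:R * L + 1).
have mL : 0 < m%:R * L + 1 by rewrite ltr_wpDl// mulr_ge0.
have e'_gt0 : 0 < e' by rewrite divr_gt0.
have Sj_near j :
    \forall y \near z, `|S j y - S j z - dot (grad (S j) z) (y - z)| <= e' * `|y - z|.
  have [sub1 sub2] := differentiable_frechet (dz j).
  near=> y; rewrite ler_norml; apply/andP; split.
    have : S j z + dot (grad (S j) z) (y - z) - e' * `|y - z| <= S j y.
      by near: y; exact: sub1.
    lra.
  have : - S j z + dot (- grad (S j) z) (y - z) - e' * `|y - z| <= - S j y.
    by near: y; exact: sub2.
  rewrite dotNl; lra.
near=> y.
have yd : `|y - x0| < d.
  near: y; apply/near_normP; exists (d - `|z - x0|); first by rewrite subr_gt0.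
  move=> y yz; rewrite -(subrK z y) -addrA (le_lt_trans (ler_normD _ _))//.
  by rewrite -ltrBrDr.
have [Syr hy _] := dP y yd; rewrite hz hy.
have h1 := nu_sub _ (ball_half r_gt0 Syr).
have : `|dot nu (Sv y - Sv z) - dot (pull nu z) (y - z)| <= m%:R * L * e' * `|y - z|.
  by apply: pull_estimate => //; [exact: ltW|near: y; exact: near_forall Sj_near].
rewrite ler_norml => /andP[h2 _].
have h3 : (m%:R * L + 1) * e' = e by rewrite /e'; field; rewrite gt_eqF.
have h4 : m%:R * L * e' * `|y - z| <= e * `|y - z|.
  by rewrite ler_wpM2r// -h3 mulrDl mul1r lerDl ltW.
lra.
Unshelve. all: by end_near. Qed.

(** A convex function of a C1 map inherits, by the chain rule, a subgradient at
    each point, and the inequalities are uniform near x0 because the map is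
    strictly differentiable there. *)
Theorem convex_composite_clarke mu : subgrad_near phi c0 r c0 mu ->
  (exists2 d, 0 < d & exists2 K, 0 <= K & forall y z, `|y - x0| < d ->
      `|z - x0| < d -> `|h y - h z| <= K * `|y - z|) /\
  clarke_subdiff h x0 (\sum_j mu 0 j *: grad (S j) x0).
Proof.
move=> mu_sub; have [d [d_gt0 dP S_lip]] := ball_data.
have K0 : 0 <= L * LS by rewrite mulr_ge0.
have h_lip y z : `|y - x0| < d -> `|z - x0| < d -> `|h y - h z| <= L * LS * `|y - z|.
  move=> yd zd; have [Sy -> _] := dP y yd; have [Sz -> _] := dP z zd.
  rewrite (le_trans (convex_lipschitz r_gt0 phi_convex phi_ge phi_le Sy Sz))//.
  by rewrite -mulrA ler_wpM2l// S_lip.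
split; first by exists d => //; exists (L * LS).
have ex z : exists nu, `|z - x0| < d -> subgrad_near phi c0 r (Sv z) nu.
  have [zd|zd] := ltP `|z - x0| d; last by exists 0.
  have [Sz _ _] := dP z zd.
  by have [nu ?] := subgrad_exists r_gt0 phi_convex phi_ge phi_le Sz; exists nu.
pose nu z := projT1 (cid (ex z)); have nuP z := projT2 (cid (ex z)).
have x0d : `|x0 - x0| < d by rewrite subrr normr0.
apply: (frechet_subgrad_clarke d_gt0 K0 h_lip (xi := fun z => pull (nu z) z)).
- by move=> z zd; exact: (frechet_pull d_gt0 dP zd (nuP z zd)).
- move=> e e_gt0; pose e' := e / (m%:R * L + 1).
  have mL : 0 < m%:R * L + 1 by rewrite ltr_wpDl// mulr_ge0.
  have e'_gt0 : 0 < e' by rewrite divr_gt0.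
  have [d1 d1_gt0 d1P] := strict e'_gt0.
  exists (Num.min d d1); first by rewrite lt_min d_gt0.
  move=> y z; rewrite !lt_min => /andP[yd yd1] /andP[zd zd1].
  have [Sy -> _] := dP y yd; have [Sz -> _] := dP z zd.
  have nu_sub := nuP z zd; have h1 := nu_sub _ (ball_half r_gt0 Sy).
  have nuL := subgrad_bound r_gt0 phi_convex phi_ge phi_le Sz nu_sub.
  have := pull_estimate nuL (ltW e'_gt0) (d1P y z yd1 zd1).
  rewrite ler_norml => /andP[h2 _].
  have h3 : (m%:R * L + 1) * e' = e by rewrite /e'; field; rewrite gt_eqF.
  have h4 : m%:R * L * e' * `|y - z| <= e * `|y - z|.
    by rewrite ler_wpM2r// -h3 mulrDl mul1r lerDl ltW.
  rewrite -/(nu z) in h1 h2 *; lra.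
- exact: (frechet_pull d_gt0 dP x0d mu_sub).
Qed.

(** The subgradient mu at c0 bounds h from below.  From above, h (y) - h (x0) is
    at most the pairing of Sv y - c0 with a subgradient at Sv y, which is close
    to mu. *)
Theorem convex_composite_differentiable mu : subgrad_near phi c0 r c0 mu ->
  (forall nu, subgrad_near phi c0 r c0 nu -> nu = mu) ->
  differentiable h x0 /\ grad h x0 = \sum_j mu 0 j *: grad (S j) x0.
Proof.
move=> mu_sub mu_uniq; have [d [d_gt0 dP S_lip]] := ball_data.
have x0d : `|x0 - x0| < d by rewrite subrr normr0.
have [c0r hx0 dx0] := dP x0 x0d.
apply: frechet_subgrad_differentiable; first exact: (frechet_pull d_gt0 dP x0d mu_sub).
have muL := subgrad_bound r_gt0 phi_convex phi_ge phi_le c0r mu_sub.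
move=> e e_gt0.
pose e' := e / (2 * (m%:R * L + 1)).
have mL : 0 < m%:R * L + 1 by rewrite ltr_wpDl// mulr_ge0.
have e'_gt0 : 0 < e' by rewrite divr_gt0// mulr_gt0.
pose e2 := e / (2 * (m%:R * LS + 1)).
have mLS : 0 < m%:R * LS + 1 by rewrite ltr_wpDl// mulr_ge0.
have e2_gt0 : 0 < e2 by rewrite divr_gt0// mulr_gt0.
have [d1 d1_gt0 d1P] := strict e'_gt0.
have [d2 d2_gt0 d2P] := subgrad_unique_continuous r_gt0 phi_convex phi_ge phi_le
  c0r mu_uniq e2_gt0.
apply/near_normP.
exists (Num.min (Num.min d d1) (d2 / (LS + 1))).
  by rewrite !lt_min d_gt0 d1_gt0 divr_gt0// ltr_wpDl.
move=> y; rewrite !lt_min => /andP[/andP[yd yd1] yd2].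
have [Sy hy _] := dP y yd; rewrite hx0 hy.
have S_lip_y := S_lip _ _ yd x0d.
have Sy2 : `|Sv y - c0| < d2.
  rewrite (le_lt_trans S_lip_y)//.
  move: yd2; rewrite ltr_pdivlMr ?ltr_wpDl//; apply: le_lt_trans.
  by rewrite mulrC ler_wpM2l// lerDl.
have [nu nu_sub] := subgrad_exists r_gt0 phi_convex phi_ge phi_le Sy.
have h1 := nu_sub _ (ball_half r_gt0 c0r).
have h2 := d2P _ _ Sy2 nu_sub.
have := ler_norm_dot (nu - mu) (Sv y - c0).
rewrite ler_norml dotBl => /andP[_ h3].
have x0d1 : `|x0 - x0| < d1 by rewrite subrr normr0.
have := pull_estimate muL (ltW e'_gt0) (d1P y x0 yd1 x0d1).
rewrite ler_norml => /andP[_ h4].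
have h5 : m%:R * (`|nu - mu| * `|Sv y - c0|) <= m%:R * (e2 * (LS * `|y - x0|)).
  by apply: ler_wpM2l => //; apply: ler_pM => //; exact: ltW.
have h6 : (m%:R * LS + 1) * e2 = e / 2 by rewrite /e2; field; rewrite gt_eqF.
have h7 : (m%:R * L + 1) * e' = e / 2 by rewrite /e'; field; rewrite gt_eqF.
have h8 : m%:R * L * e' * `|y - x0| <= e / 2 * `|y - x0|.
  by rewrite ler_wpM2r// -h7 mulrDl mul1r lerDl ltW.
have h9 : m%:R * LS * e2 * `|y - x0| <= e / 2 * `|y - x0|.
  by rewrite ler_wpM2r// -h6 mulrDl mul1r lerDl ltW.
have h10 : dot nu (c0 - Sv y) = - dot nu (Sv y - c0) by rewrite -dotNr opprB.
rewrite dotNl -/(pull mu x0); rewrite -/c0 in h4; rewrite h10 in h1.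
lra.
Qed.

End ConvexComposite.

(** * The perturbation function and Lagrange duality *)

Lemma convex_functionP {R : realType} {n : nat} (g : 'rV[R]_n -> R) x y t :
  convex_function setT g -> 0 <= t -> t <= 1 ->
  g (t *: x + (1 - t) *: y) <= t * g x + (1 - t) * g y.
Proof.
move=> g_convex t0 t1; have t01 : 0 <= t <= 1 by rewrite t0 t1.
by have := g_convex (Itv01 t0 t1) x y; rewrite !in_setT => /(_ isT isT).
Qed.

Lemma econvexP {R : realType} {n : nat} (f : 'rV[R]_n -> \bar R) x y t u v :
  econvex f -> 0 <= t -> t <= 1 -> (f x <= u%:E)%E -> (f y <= v%:E)%E ->
  (f (t *: x + (1 - t) *: y)%R <= (t * u + (1 - t) * v)%:E)%E.
Proof.
move=> f_convex t0 t1 fu fv; have := f_convex (Itv01 t0 t1) x y.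
move=> /le_trans; apply; rewrite [leRHS]EFinD !EFinM.
by apply: leeD; apply: lee_wpmul2l; rewrite // lee_fin// subr_ge0.
Qed.

Section Perturbation.
Context {R : realType} {n m : nat}.
Variables (X : set 'rV[R]_n) (f : 'rV[R]_n -> \bar R).
Variables (a : 'I_m -> 'rV[R]_n -> R) (b : 'I_m -> R).
Implicit Types (c mu nu : 'rV[R]_m) (x : 'rV[R]_n) (y t e : R).

Definition perturbation c : \bar R :=
  ereal_inf [set f x | x in [set x | X x /\ forall j, a j x + c 0 j <= b j]].

Definition lagrange_dual c nu : \bar R :=
  ereal_inf [set (f x + (\sum_j nu 0 j * (a j x + c 0 j - b j))%:E)%E | x in X].

Hypotheses (X_convex : convex_set X) (f_gtNy : forall x, (-oo < f x)%E).
Hypotheses (f_convex : econvex f) (a_convex : forall j, convex_function setT (a j)).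
Hypothesis f_bounded_below : (-oo < ereal_inf [set f x | x in X])%E.

(** The pairs above the graph of [perturbation] that a feasible point realises.
    They form a convex set; the infimum itself may not be attained. *)
Definition attains c y :=
  exists2 x, X x & (f x <= y%:E)%E /\ forall j, a j x + c 0 j <= b j.

Lemma attains_convex c c' y y' t : attains c y -> attains c' y' ->
  0 <= t -> t <= 1 -> attains (t *: c + (1 - t) *: c') (t * y + (1 - t) * y').
Proof.
move=> [x Xx [fx ax]] [x' Xx' [fx' ax']] t0 t1.
have t'0 : 0 <= 1 - t by rewrite subr_ge0.
exists (t *: x + (1 - t) *: x'); first exact: convex_setP.
split; first exact: econvexP.
move=> j; rewrite !mxE; have := convex_functionP x x' (a_convex j) t0 t1.
have := ler_wpM2l t0 (ax j); have := ler_wpM2l t'0 (ax' j); lra.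
Qed.

Lemma attains_le c c' y y' : attains c y -> (forall j, c' 0 j <= c 0 j) -> y <= y' ->
  attains c' y'.
Proof.
move=> [x Xx [fx ax]] cc yy; exists x => //; split.
  by rewrite (le_trans fx)// lee_fin.
by move=> j; rewrite (le_trans _ (ax j))// lerD2l.
Qed.

Variables (c0 : 'rV[R]_m) (xbar : 'rV[R]_n).
Hypotheses (X_xbar : X xbar) (f_xbar : (f xbar < +oo)%E).
Hypothesis slater : forall j, a j xbar + c0 0 j < b j.

Let M0 := fine (f xbar).
Let m0 := fine (ereal_inf [set f x | x in X]).

Let f_xbarE : f xbar = M0%:E.
Proof. by rewrite /M0 fineK// fin_real// f_gtNy f_xbar. Qed.

Let inf_f : ereal_inf [set f x | x in X] = m0%:E.
Proof.
rewrite /m0 fineK// fin_real// f_bounded_below/=.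
by apply: le_lt_trans f_xbar; apply: ereal_inf_lbound; exists xbar.
Qed.

Let m0_le x : X x -> (m0%:E <= f x)%E.
Proof. by move=> Xx; rewrite -inf_f; apply: ereal_inf_lbound; exists x. Qed.

Lemma slater_radius : exists2 r, 0 < r &
  forall c, `|c - c0| < r -> attains c M0.
Proof.
have : \forall r \near 0^'+, 0 < r /\ forall j, r <= b j - (a j xbar + c0 0 j).
  near=> r; split => //; near: r; apply: filter_forall => j.
  by apply: nbhs_right_le; rewrite subr_gt0.
move=> /filter_ex[r [r_gt0 rP]]; exists r => // c cr.
exists xbar => //; split; first by rewrite f_xbarE.
move=> j; have := normr_coord (c - c0) j; rewrite !mxE ler_norml => /andP[_ h].
by have := rP j; lra.
Unshelve. all: by end_near. Qed.

Let phi c := fine (perturbation c).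

Let perturbation_le c y : attains c y -> (perturbation c <= y%:E)%E.
Proof.
move=> [x Xx [fx ax]]; apply: le_trans fx; apply: ereal_inf_lbound.
by exists x.
Qed.

Let perturbation_ge c : (m0%:E <= perturbation c)%E.
Proof. by apply: le_ereal_inf_tmp => _ [x [Xx _] <-]; exact: m0_le. Qed.

Lemma perturbation_fin c y : attains c y -> perturbation c \is a fin_num.
Proof.
move=> cy; rewrite fin_real// (lt_le_trans _ (perturbation_ge c)) ?ltNyr//=.
by rewrite (le_lt_trans (perturbation_le cy))// ltry.
Qed.

Let phi_le c y : attains c y -> phi c <= y.
Proof.
by move=> cy; rewrite -lee_fin /phi fineK ?perturbation_le// (perturbation_fin cy).
Qed.

Let phi_adherent c y e : attains c y -> 0 < e ->
  exists2 y', attains c y' & y' < phi c + e.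
Proof.
move=> cy e0; have c_fin := perturbation_fin cy.
have [_ [x [Xx ax] <-]] := lb_ereal_inf_adherent e0 c_fin.
rewrite -/(perturbation c) -(fineK c_fin) -EFinD => fx.
have fxE : f x = (fine (f x))%:E.
  by rewrite fineK// fin_real// f_gtNy (lt_trans fx)// ltry.
exists (fine (f x)); last by rewrite -lte_fin -fxE.
by exists x => //; rewrite -fxE.
Qed.

Variable r : R.
Hypotheses (r_gt0 : 0 < r) (attains_ball : forall c, `|c - c0| < r -> attains c M0).

Let c0r : `|c0 - c0| < r. Proof. by rewrite subrr normr0. Qed.

Lemma perturbation_convex c c' t : `|c - c0| < r -> `|c' - c0| < r -> 0 <= t -> t <= 1 ->
  phi (t *: c + (1 - t) *: c') <= t * phi c + (1 - t) * phi c'.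
Proof.
move=> cr c'r t0 t1; apply/ler_addgt0Pr => e e0.
have [y cy ye] := phi_adherent (attains_ball cr) e0.
have [y' cy' ye'] := phi_adherent (attains_ball c'r) e0.
have t'0 : 0 <= 1 - t by rewrite subr_ge0.
have := phi_le (attains_convex cy cy' t0 t1).
have := ler_wpM2l t0 (ltW ye); have := ler_wpM2l t'0 (ltW ye'); lra.
Qed.

Lemma perturbation_ge_inf c : `|c - c0| < r -> m0 <= phi c.
Proof.
move=> /attains_ball/perturbation_fin c_fin.
by rewrite -lee_fin /phi (fineK c_fin) perturbation_ge.
Qed.

Lemma perturbation_le_slater c : `|c - c0| < r -> phi c <= M0.
Proof. by move=> /attains_ball/phi_le. Qed.

(** Every attained pair (c, y) is joined to the pairs attained at c0 by segments
    that start over the ball, where the inequality holds, and convexity carries it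
    to the far end. *)
Lemma subgrad_global nu : subgrad_near phi c0 r c0 nu ->
  forall c y, attains c y -> phi c0 + dot nu (c - c0) <= y.
Proof.
move=> nu_sub c y cy; apply/ler_addgt0Pr => e e_gt0.
pose N := `|c - c0| + 1; have N_gt0 : 0 < N by rewrite ltr_wpDl.
pose t := Num.min 1 (r / (2 * N)).
have t_gt0 : 0 < t by rewrite lt_min ltr01 divr_gt0// mulr_gt0.
have [t1 tr] : t <= 1 /\ t <= r / (2 * N) by split; rewrite ge_min lexx ?orbT.
have [y0 cy0 ye] := phi_adherent (attains_ball c0r) (mulr_gt0 t_gt0 e_gt0).
pose ct := t *: c + (1 - t) *: c0.
have ctE : ct - c0 = t *: (c - c0) by apply/rowP => i; rewrite !mxE; ring.
have ct_r : `|ct - c0| < r.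
  rewrite ctE normrZ gtr0_norm//.
  have : t * N < r.
    rewrite (le_lt_trans (ler_wpM2r (ltW N_gt0) tr))// invfM mulrA divfK ?gt_eqF//.
    by rewrite ltr_pdivrMr// ltr_pMr// ltr1n.
  by apply: le_lt_trans; rewrite ler_wpM2l ?(ltW t_gt0)// lerDl.
have := nu_sub ct ct_r; rewrite ctE dotZr => h1.
have h2 := phi_le (attains_convex cy cy0 (ltW t_gt0) t1).
have t'0 : 0 <= 1 - t by rewrite subr_ge0.
have h3 := ler_wpM2l t'0 (ltW ye).
have h4 : (1 - t) * (t * e) <= t * e.
  by rewrite ler_piMl ?(ltW (mulr_gt0 t_gt0 e_gt0))// lerBlDr lerDl ltW.
rewrite -(ler_pM2l t_gt0); rewrite -/ct in h2; lra.
Qed.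

(** Lowering c_j relaxes the j-th constraint, so the perturbation function does
    not increase. *)
Lemma subgrad_ge0 nu j : subgrad_near phi c0 r c0 nu -> 0 <= nu 0 j.
Proof.
move=> nu_sub; apply/ler_addgt0Pr => e e_gt0.
have [y c0y ye] := phi_adherent (attains_ball c0r) e_gt0.
have cy : attains (c0 - delta_mx 0 j) y.
  by apply: attains_le c0y _ (lexx y) => i; rewrite !mxE gerBl; case: (_ && _).
have := subgrad_global nu_sub cy; rewrite (addrC c0) addrK dotNr dot_delta.
lra.
Qed.

(** A point x of X is feasible for c_j = b_j - a_j (x), and the subgradient
    inequality at that c bounds the Lagrangian at x from below. *)
Lemma subgrad_dual_ge nu : subgrad_near phi c0 r c0 nu ->
  ((phi c0)%:E <= lagrange_dual c0 nu)%E.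
Proof.
move=> nu_sub; apply: le_ereal_inf_tmp => _ [x Xx <-].
have [fx|] := boolP (f x \is a fin_num); last first.
  rewrite fin_numE negb_and !negbK => /orP[/eqP fx|/eqP ->].
    by have := f_gtNy x; rewrite fx.
  by rewrite addye// leey.
rewrite -(fineK fx) -EFinD lee_fin.
have cy : attains (\row_j (b j - a j x)) (fine (f x)).
  exists x => //; split; first by rewrite fineK.
  by move=> j; rewrite mxE addrC subrK.
have := subgrad_global nu_sub cy; rewrite dotBr /dot -sumrB => h.
rewrite -lerBlDr (le_trans _ h)// lerD2l -sumrN ler_sum// => j _.
by rewrite mxE -mulrBr -mulrN ler_wpM2l ?subgrad_ge0//; lra.
Qed.

(** Points feasible at c0 give weak duality, phi c0 >= lagrange_dual c0 kappa, and
    the multiplier nu attains this bound. *)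
Lemma subgrad_dual_opt nu : subgrad_near phi c0 r c0 nu ->
  (forall j, 0 <= nu 0 j) /\ forall kappa : 'rV[R]_m, (forall j, 0 <= kappa 0 j) ->
    (lagrange_dual c0 kappa <= lagrange_dual c0 nu)%E.
Proof.
move=> nu_sub; split=> [j|kappa kappa_ge0]; first exact: subgrad_ge0.
apply: (@le_trans _ _ (phi c0)%:E); last exact: subgrad_dual_ge.
apply/lee_addgt0Pr => e e_gt0; rewrite -EFinD.
have [y [x Xx [fx ax]] ye] := phi_adherent (attains_ball c0r) e_gt0.
apply: (@le_trans _ _ (f x + (\sum_j kappa 0 j * (a j x + c0 0 j - b j))%:E)%E).
  by apply: ereal_inf_lbound; exists x.
apply: (@le_trans _ _ (y%:E + 0)%E).
  apply: leeD => //; rewrite lee_fin; apply: sumr_le0 => j _.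
  by rewrite mulr_ge0_le0// subr_le0.
by rewrite adde0 lee_fin ltW.
Qed.

(** The dual optimum equals phi c0 because some subgradient attains it; an
    optimal mu then bounds the Lagrangian below by phi c0, and at a point feasible
    for c this is the subgradient inequality. *)
Lemma dual_opt_subgrad mu : (forall j, 0 <= mu 0 j) ->
  (forall nu : 'rV[R]_m, (forall j, 0 <= nu 0 j) ->
    (lagrange_dual c0 nu <= lagrange_dual c0 mu)%E) ->
  subgrad_near phi c0 r c0 mu.
Proof.
move=> mu_ge0 mu_opt.
have c0r2 : `|c0 - c0| < r / 2 by rewrite subrr normr0 divr_gt0.
have [nu nu_sub] := subgrad_exists r_gt0 perturbation_convex perturbation_ge_inf
  perturbation_le_slater c0r2.
have phi_dual : ((phi c0)%:E <= lagrange_dual c0 mu)%E.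
  apply: le_trans (mu_opt nu (fun j => subgrad_ge0 j nu_sub)).
  exact: subgrad_dual_ge.
move=> c cr; apply/ler_addgt0Pr => e e_gt0.
have [y [x Xx [fx ax]] ye] := phi_adherent (attains_ball cr) e_gt0.
have h : ((phi c0)%:E <= f x + (\sum_j mu 0 j * (a j x + c0 0 j - b j))%:E)%E.
  by apply: le_trans phi_dual _; apply: ereal_inf_lbound; exists x.
have {h} : ((phi c0)%:E <= y%:E + (\sum_j mu 0 j * (a j x + c0 0 j - b j))%:E)%E.
  by apply: le_trans h _; apply: leeD.
rewrite -EFinD lee_fin => h.
have h2 : \sum_j mu 0 j * (a j x + c0 0 j - b j) <= - dot mu (c - c0).
  rewrite dotBr /dot -sumrB -sumrN; apply: ler_sum => j _.
  by rewrite -mulrBr -mulrN ler_wpM2l//; have := ax j; lra.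
lra.
Qed.

(** [convex_composite_clarke] and [convex_composite_differentiable] apply to the
    perturbation function, whose subgradients at c0 are the dual optima. *)
Theorem perturbation_sensitivity p (S : 'I_m -> 'rV[R]_p -> R) (x0 : 'rV[R]_p)
    (V : 'rV[R]_p -> \bar R) mu :
  c0 = \row_j S j x0 ->
  (\forall z \near x0, forall j, differentiable (S j) z) ->
  (forall j, {for x0, continuous (grad (S j))}) ->
  (\forall z \near x0, V z = perturbation (\row_j S j z)) ->
  (forall j, 0 <= mu 0 j) ->
  (forall nu : 'rV[R]_m, (forall j, 0 <= nu 0 j) ->
    (lagrange_dual c0 nu <= lagrange_dual c0 mu)%E) ->
  let g := \sum_j mu 0 j *: grad (S j) x0 in
  [/\ finite_lipschitz_near V x0,
      clarke_subdiff (fun z => fine (V z)) x0 g &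
      (forall nu, (forall j, 0 <= nu 0 j) ->
         (forall kappa : 'rV[R]_m, (forall j, 0 <= kappa 0 j) ->
            (lagrange_dual c0 kappa <= lagrange_dual c0 nu)%E) -> nu = mu) ->
      differentiable (fun z => fine (V z)) x0 /\ grad (fun z => fine (V z)) x0 = g].
Proof.
move=> c0E S_diff S_C1 V_eq mu_ge0 mu_opt g.
have mu_sub := dual_opt_subgrad mu_ge0 mu_opt.
have dual_opt_uniq := subgrad_dual_opt.
have pc := perturbation_convex; have pge := perturbation_ge_inf.
have ple := perturbation_le_slater; have pball := attains_ball.
rewrite c0E in mu_sub dual_opt_uniq pc pge ple pball.
have h_eq : \forall z \near x0, fine (V z) = phi (\row_j S j z).
  by apply: filterS V_eq => z ->.
have [[d d_gt0 [K K_ge0 V_lip]] V_clarke] :=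
  convex_composite_clarke r_gt0 pc pge ple S_diff S_C1 h_eq mu_sub.
split => //.
  have /near_normP[d1 d1_gt0 d1P] : \forall z \near x0, V z \is a fin_num.
    have := near_image_ball r_gt0 S_diff; apply: filterS2 V_eq => z -> /pball.
    exact: perturbation_fin.
  exists [set z | `|z - x0| < Num.min d d1].
    by apply/near_normP; exists (Num.min d d1) => //; rewrite lt_min d_gt0.
  split=> [z|]; first by rewrite /= lt_min => /andP[_ /d1P].
  exists K; split; first by rewrite num_real.
  move=> M KM [y z] [/=]; rewrite !lt_min => /andP[yd _] /andP[zd _].
  by rewrite (le_trans (V_lip y z yd zd))// ler_wpM2r// ltW.
move=> mu_uniq.
apply: (convex_composite_differentiable r_gt0 pc pge ple S_diff S_C1 h_eq mu_sub).
move=> nu nu_sub; have [nu_ge0 nu_opt] := dual_opt_uniq nu nu_sub.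
by apply: mu_uniq => //; rewrite c0E.
Qed.

End Perturbation.

(** * Uncertainty sets and their support functions *)

Section Support.
Context {R : realType} {k : nat}.
Implicit Types (C : set 'rV[R]_k) (w u : 'rV[R]_k) (r t : R).

Lemma support_fin_num C w : C !=set0 -> compact C -> support C w \is a fin_num.
Proof.
move=> [u0 Cu0] /compact_bounded[M [_ CM]].
pose N := k%:R * (`|w| * (M + 1)).
have CN u : C u -> `|dot w u| <= N.
  move=> Cu; rewrite (le_trans (ler_norm_dot _ _))// ler_wpM2l// ler_wpM2l//.
  by apply: CM => //; rewrite ltrDl.
have sup_le : (support C w <= N%:E)%E.
  apply: ge_ereal_sup => _ [u Cu <-]; rewrite lee_fin.
  by have := CN u Cu; rewrite ler_norml => /andP[].
rewrite fin_real// (le_lt_trans sup_le) ?ltry// andbT.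
apply: (@lt_le_trans _ _ (dot w u0)%:E); first exact: ltNyr.
by apply: ereal_sup_ubound; exists u0.
Qed.

Lemma support_scale_le C w r : 0 < r ->
  (support [set (r *: u)%R | u in C] w <= r%:E * support C w)%E.
Proof.
move=> r0; apply: ge_ereal_sup => _ [_ [u Cu <-] <-].
rewrite dotZr EFinM lee_pmul2l//.
by apply: ereal_sup_ubound; exists u.
Qed.

Lemma support_scale C w r : 0 < r ->
  (support [set (r *: u)%R | u in C] w = r%:E * support C w)%E.
Proof.
move=> r0; apply/eqP; rewrite eq_le support_scale_le//=.
rewrite -lee_pdivlMl// (le_trans _ (support_scale_le _ _ _)) ?invr_gt0//.
rewrite (_ : [set r^-1 *: u | u in [set r *: u | u in C]] = C)//.
apply/seteqP; split => [_ [_ [u Cu <-] <-]|u Cu].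
  by rewrite scalerA mulVf ?scale1r// gt_eqF.
exists (r *: u); first by exists u.
by rewrite scalerA mulVf ?scale1r// gt_eqF.
Qed.

End Support.

Section UncertaintySet.
Context {R : realType} {p d : nat}.
Variables (s : 'rV[R]_p -> 'rV[R]_d -> R) (theta : 'rV[R]_p).
Hypothesis s_gauge : forall u, (s theta u)%:E = gauge (uset s theta 1) u.
Implicit Types (u w : 'rV[R]_d) (rho r t : R).

(** If u lies in t C then r u lies in (r t) C.  Applied to r and to its inverse,
    this makes the gauge positively homogeneous. *)
Lemma gauge_scale_le r u : 0 < r -> s theta (r *: u) <= r * s theta u.
Proof.
move=> r_gt0; apply/ler_addgt0Pr => e e_gt0.
have su_fin : gauge (uset s theta 1) u \is a fin_num by rewrite -s_gauge.
have er : 0 < e / r by rewrite divr_gt0.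
have [_ [t [t_gt0 [v Uv <-]] <-]] := lb_ereal_inf_adherent er su_fin.
rewrite -/(gauge _ _) -s_gauge -EFinD lte_fin => tu.
have : (gauge (uset s theta 1) (r *: (t *: v)) <= (r * t)%:E)%E.
  apply: ereal_inf_lbound; exists (r * t) => //; split; first exact: mulr_gt0.
  by exists v; rewrite ?scalerA.
rewrite -s_gauge lee_fin => /le_trans; apply.
move/ltW: tu => /(ler_wpM2l (ltW r_gt0)); rewrite mulrDr.
by rewrite [r * (e / r)]mulrC divfK// gt_eqF.
Qed.

Lemma uset_scale rho : 0 < rho ->
  uset s theta rho = [set rho *: u | u in uset s theta 1].
Proof.
move=> rho_gt0; apply/seteqP; split => [u /= su|_ [u /= su <-]].
  exists (rho^-1 *: u); last by rewrite scalerA mulfV ?scale1r// gt_eqF.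
  rewrite /uset/= (le_trans (gauge_scale_le _ _)) ?invr_gt0//.
  by rewrite ler_pdivrMl// mulr1.
rewrite /uset/= (le_trans (gauge_scale_le _ _))//.
by rewrite -[leRHS]mulr1 ler_pM2l.
Qed.

Lemma support_uset rho w : 0 < rho ->
  (support (uset s theta rho) w = rho%:E * support (uset s theta 1) w)%E.
Proof. by move=> rho_gt0; rewrite uset_scale// support_scale. Qed.

End UncertaintySet.

Lemma grad_dot {R : realType} {k : nat} (g z : 'rV[R]_k) :
  differentiable (dot g : 'rV[R]_k -> R) z /\ grad (dot g) z = g.
Proof.
apply: frechet_subgrad_differentiable => e e_gt0; near=> y;
  have : 0 <= e * `|y - z| by rewrite mulr_ge0// ltW.
  rewrite dotBr; lra.
rewrite dotNl dotBr; lra.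
Unshelve. all: by end_near. Qed.

(** Inside D the relative increments are ordinary ones, so the witness of the
    definition is the gradient. *)
Lemma C1_interior {R : realType} {k : nat} (D : set 'rV[R]_k) (h : 'rV[R]_k -> R)
    (x : 'rV[R]_k) : C1_locbounded_on D h -> interior D x ->
  (\forall z \near x, differentiable h z) /\ {for x, continuous (grad h)}.
Proof.
move=> [G [hG Gc _]] Dx.
have gradG z : interior D z -> differentiable h z /\ grad h z = G z.
  move=> Dz; have /eqoP hGz := hG z (interior_subset Dz).
  have est e : 0 < e ->
      \forall y \near z, `|h y - h z - dot (G z) (y - z)| <= e * `|y - z|.
    move=> e_gt0; have := hGz e e_gt0; rewrite near_withinE.
    by move=> /filterS2 /(_ Dz); apply => y; apply.
  apply: frechet_subgrad_differentiable => e e_gt0; apply: filterS (est e e_gt0) => y.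
    by rewrite ler_norml => /andP[]; lra.
  by rewrite ler_norml dotNl => /andP[]; lra.
have near_int : \forall z \near x, interior D z.
  exact: open_nbhs_nbhs (conj (open_interior D) Dx).
split; first by apply: filterS near_int => z /gradG[].
have /subspace_continuousP/(_ x (interior_subset Dx)) := Gc.
rewrite (within_interior Dx) => Gx.
rewrite /prop_for /continuous_at (gradG x Dx).2.
move=> A /Gx GA; have {}GA : \forall z \near x, A (G z) := GA.
have : \forall z \near x, A (grad h z).
  by apply: filterS2 near_int GA => z /gradG[_ ->].
exact.
Qed.

(** * The robust problem *)

Section RobustCounterpart.
Context {R : realType} {p d n m : nat}.
Variables (s : 'rV[R]_p -> 'rV[R]_d -> R) (X : set 'rV[R]_n).
Variables (f : 'rV[R]_n -> \bar R) (a : 'I_m -> 'rV[R]_n -> R).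
Variables (w : 'I_m -> 'rV[R]_d) (b : 'I_m -> R) (theta : 'rV[R]_p) (rho : R).
Variable c : 'rV[R]_m.
Hypothesis cE : forall j, support (uset s theta rho) (w j) = (c 0 j)%:E.

Lemma value_perturbation : value s X f a w b theta rho = perturbation X f a b c.
Proof.
rewrite /value /perturbation; congr (ereal_inf (_ @` _)).
apply/seteqP; split => x [Xx ax]; split => // j; have := ax j.
  by rewrite cE -EFinD lee_fin.
by rewrite cE -EFinD lee_fin.
Qed.

Lemma dual_fun_lagrange nu :
  dual_fun s X f a w b theta rho nu = lagrange_dual X f a b c nu.
Proof.
rewrite /dual_fun /lagrange_dual; congr ereal_inf.
apply: eq_imagel => x _; congr (_ + _)%E.
by rewrite -sumEFin; apply: eq_bigr => j _; rewrite cE.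
Qed.

End RobustCounterpart.

Theorem proposition2 (R : realType) (p d n m : nat) (d_ge1 : (1 <= d)%N)
  (Theta : set 'rV[R]_p)
  (s : 'rV[R]_p -> 'rV[R]_d -> R)
  (X : set 'rV[R]_n) (f : 'rV[R]_n -> \bar R)
  (a : 'I_m -> 'rV[R]_n -> R) (w : 'I_m -> 'rV[R]_d) (b : 'I_m -> R)
  (V := value s X f a w b)
  (sigma := fun (j : 'I_m) (theta : 'rV[R]_p) (rho : R) =>
     support (uset s theta rho) (w j))
  (s_ge0 : forall theta, Theta theta -> forall u, 0 <= s theta u)
  (s_gauge : forall theta, Theta theta -> forall u,
     (s theta u)%:E = gauge (uset s theta 1) u)
  (X_closed : closed X) (X_convex : convex_set X)
  (f_gtNy : forall x, (-oo < f x)%E) (f_convex : econvex f)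
  (a_convex : forall j, convex_function setT (a j))
  (theta : 'rV[R]_p) (rho : R)
  (theta_in : Theta theta) (rho_gt0 : 0 < rho)
  (V_lty : (V theta rho < +oo)%E)
  (unit_sets : forall theta', Theta theta' ->
     [/\ uset s theta' 1 !=set0, convex_set (uset s theta' 1),
         compact (uset s theta' 1) & interior (uset s theta' 1) 0])
  (f_bounded_below : (-oo < ereal_inf [set f x | x in X])%E)
  (slater : exists xbar, [/\ relint X xbar, (f xbar < +oo)%E &
     forall j, ((a j xbar)%:E + sigma j theta rho < (b j)%:E)%E])
  (sigma_C1 : forall j rho', 0 < rho' ->
     C1_locbounded_on Theta (fun theta' => fine (sigma j theta' rho')))
  (mu : 'rV[R]_m) (mu_opt : dual_opt s X f a w b theta rho mu) :
  let g_theta := \sum_(j < m)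
    mu 0 j *: grad (fun theta' => fine (sigma j theta' rho)) theta in
  let g_rho := \sum_(j < m) mu 0 j * fine (sigma j theta 1) in
  (interior Theta theta ->
     [/\ finite_lipschitz_near (fun theta' => V theta' rho) theta,
         clarke_subdiff (fun theta' => fine (V theta' rho)) theta g_theta &
         dual_opt s X f a w b theta rho = [set mu] ->
           differentiable (fun theta' => fine (V theta' rho)) theta /\
           grad (fun theta' => fine (V theta' rho)) theta = g_theta]) /\
  (finite_lipschitz_near (fun r : 'rV[R]_1 => V theta (r 0 0)) (const_mx rho) /\
   clarke_subdiff (fun r : 'rV[R]_1 => fine (V theta (r 0 0)))
     (const_mx rho) (const_mx g_rho)).
Proof.
move=> g_theta g_rho.
have [xbar [[X_xbar _] f_xbar slater_xbar]] := slater.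
have sigma_fin theta' rho' j : Theta theta' -> 0 < rho' ->
    sigma j theta' rho' = (fine (sigma j theta' rho'))%:E.
  move=> Ttheta' rho'_gt0; rewrite fineK// /sigma support_uset//; last exact: s_gauge.
  have [U0 _ Uc _] := unit_sets _ Ttheta'.
  by rewrite fin_numM// support_fin_num.
pose c (theta' : 'rV[R]_p) rho' : 'rV[R]_m := \row_j fine (sigma j theta' rho').
have cE theta' rho' j : Theta theta' -> 0 < rho' ->
    support (uset s theta' rho') (w j) = (c theta' rho' 0 j)%:E.
  by move=> Ttheta' rho'_gt0; rewrite mxE; exact: sigma_fin.
have VE theta' rho' : Theta theta' -> 0 < rho' ->
    V theta' rho' = perturbation X f a b (c theta' rho').
  by move=> Ttheta' rho'_gt0; apply: value_perturbation => j; exact: cE.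
have dualE nu : dual_fun s X f a w b theta rho nu =
    lagrange_dual X f a b (c theta rho) nu.
  by apply: dual_fun_lagrange => j; exact: cE.
have slater_c j : a j xbar + c theta rho 0 j < b j.
  by rewrite -lte_fin EFinD -cE//; exact: slater_xbar.
have [r r_gt0 ball_attains] := slater_radius f_gtNy X_xbar f_xbar slater_c.
have [mu_ge0 mu_max] := mu_opt.
have mu_dual (nu : 'rV[R]_m) : (forall j, 0 <= nu 0 j) ->
    (lagrange_dual X f a b (c theta rho) nu <=
     lagrange_dual X f a b (c theta rho) mu)%E.
  by move=> nu_ge0; rewrite -!dualE; exact: mu_max.
have sens q := @perturbation_sensitivity R n m X f a b X_convex f_gtNy f_convex
  a_convex f_bounded_below _ xbar X_xbar f_xbar r r_gt0 ball_attains q.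
split.
  (* theta is interior to Theta, so the support values are finite and C1 around
     it, and V is there a function of them. *)
  move=> theta_int.
  have C1 j := C1_interior (sigma_C1 j rho rho_gt0) theta_int.
  have [|||lip clarke uniq] := sens p (fun j theta' => fine (sigma j theta' rho))
    theta (fun theta' => V theta' rho) mu erefl _ _ _ mu_ge0 mu_dual.
  - by apply: near_forall => j; have [] := C1 j.
  - by move=> j; have [] := C1 j.
  - by apply: filterS theta_int => theta' Ttheta'; exact: VE.
  split => // dual_uniq; apply: uniq => nu nu_ge0 nu_max.
  suff : dual_opt s X f a w b theta rho nu by rewrite dual_uniq.
  by split => // kappa kappa_ge0; rewrite !dualE; exact: nu_max.
(* By homogeneity of the gauge, the support values are linear in the radius. *)
pose sg j : 'rV[R]_1 := const_mx (fine (sigma j theta 1)).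
have sgE j (z : 'rV[R]_1) : dot (sg j) z = z 0 0 * fine (sigma j theta 1).
  by rewrite /dot big_ord1 mxE mulrC.
have c_dot rho' : 0 < rho' -> c theta rho' = \row_j dot (sg j) (const_mx rho').
  move=> rho'_gt0; apply/rowP => j; rewrite !mxE sgE mxE.
  apply: EFin_inj; rewrite EFinM -!sigma_fin//.
  by rewrite /sigma support_uset//; exact: s_gauge.
have grad_sg j : grad (dot (sg j)) = cst (sg j).
  by apply/funext => z; rewrite (grad_dot _ _).2.
have [|||lip clarke _] := sens 1%N (fun j => dot (sg j)) (const_mx rho)
  (fun z => V theta (z 0 0)) mu (c_dot _ rho_gt0) _ _ _ mu_ge0 mu_dual.
- by apply: near_forall => j; near=> z; exact: (grad_dot _ _).1.
- by move=> j; rewrite grad_sg; exact: cst_continuous.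
- apply/near_normP; exists rho => // z zrho.
  have z_gt0 : 0 < z 0 0.
    have := le_lt_trans (normr_coord _ 0) zrho; rewrite !mxE ltr_norml.
    by move=> /andP[]; lra.
  rewrite VE// c_dot//; congr perturbation; apply/rowP => j; rewrite !mxE.
  by congr dot; apply/rowP => i; rewrite mxE ord1.
split => //.
suff -> : const_mx g_rho = \sum_j mu 0 j *: grad (dot (sg j)) (const_mx rho) by [].
apply/rowP => i; rewrite mxE summxE; apply: eq_bigr => j _.
by rewrite grad_sg !mxE.
Unshelve. all: by end_near. Qed.
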